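(* Let $N,L\ge1$, let $\Phi\in\mathbb{R}^{N\times L}$ be a known matrix with columns $\Phi_1,\dots,\Phi_L$, and $\sigma^2>0$ known. For an unknown deterministic $\gamma=(\gamma_1,\dots,\gamma_L)^T\in(0,\infty)^L$ let $\Upsilon=\mathrm{diag}(\gamma_1,\dots,\gamma_L)$ and $y=\Phi x+n$ with $x\sim\mathcal{N}(0,\Upsilon)$, $n\sim\mathcal{N}(0,\sigma^2I_N)$ independent, and let $p(y;\gamma)$ denote the marginal density of $y$. Put $\Sigma_y=\sigma^2I_N+\Phi\Upsilon\Phi^T$. Then: (i) the log likelihood satisfies the regularity condition $\mathbb{E}_{Y;\gamma}\left[\frac{\partial}{\partial\gamma_j}\log p(y;\gamma)\right]=0$ for all $1\le j\le L$ and all $\gamma\in(0,\infty)^L$; (ii) the Fisher information matrix $\mathbf{M}^\gamma$ of the marginalized model has entries $$\mathbf{M}^{\gamma}_{ij}=\frac12\left(\Phi_j^T\Sigma_y^{-1}\Phi_i\right)^2,\qquad 1\le i,j\le L,$$ and, whenever $\mathbf{M}^\gamma$ is non-singular, every admissible estimator $\hat\gamma(y)$ of $\gamma$ satisfies $\mathbf{E}^{\gamma}\succeq(\mathbf{M}^{\gamma})^{-1}$.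
   Context: $A\succeq B$ means $A-B$ is positive semidefinite. $\mathbb{E}_{Y;\gamma}$ denotes expectation with respect to $p(y;\gamma)$. The Fisher information matrix is $\mathbf{M}^\gamma_{ij}=-\mathbb{E}_{Y;\gamma}\left[\frac{\partial^2}{\partial\gamma_i\partial\gamma_j}\log p(y;\gamma)\right]$. For a measurable estimator $\hat\gamma:\mathbb{R}^N\to\mathbb{R}^L$ the MSE matrix is $\mathbf{E}^\gamma=\mathbb{E}_{Y;\gamma}[(\gamma-\hat\gamma(y))(\gamma-\hat\gamma(y))^T]$. An estimator is admissible if, for every $\gamma\in(0,\infty)^L$, $\mathbf{E}^\gamma$ exists (has finite entries) and $\mathbb{E}_{Y;\gamma}[\hat\gamma(y)]=\gamma$ (unbiasedness). *)

(* Defs.v *)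
From HB Require Import structures.
From mathcomp Require Import all_boot all_order all_algebra.
From mathcomp Require Import all_classical all_reals all_analysis.

Set Implicit Arguments.
Unset Strict Implicit.
Unset Printing Implicit Defensive.

Import Order.TTheory GRing.Theory Num.Theory.
Import numFieldNormedType.Exports.

Local Open Scope classical_set_scope.
Local Open Scope ring_scope.

Section cons_measure.
Context {d : measure_display} {T : measurableType d} {R : realType} (n : nat).
Variables (m1 : {sigma_finite_measure set T -> \bar R})
  (m2 : {sigma_finite_measure set (n.-tuple T) -> \bar R}).

Definition tcons (x : T * n.-tuple T) : n.+1.-tuple T :=
  cons_tuple x.1 x.2.

Lemma measurable_tcons : measurable_fun setT tcons.
Proof. exact: measurable_cons. Qed.

Definition cons_measure : set (n.+1.-tuple T) -> \bar R :=
  pushforward (m1 \x m2)%E tcons.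

Let cons_measure_set0 : cons_measure set0 = 0%E.
Proof. by rewrite /cons_measure /pushforward preimage_set0 measure0. Qed.

Let cons_measure_ge0 A : (0 <= cons_measure A)%E.
Proof. exact: (measure_ge0 (m1 \x m2)%E). Qed.

Let cons_measure_sigma_additive : semi_sigma_additive cons_measure.
Proof.
move=> F mF tF mUF; rewrite /cons_measure /pushforward preimage_bigcup.
apply: measure_semi_sigma_additive.
- by move=> k; rewrite -[X in measurable X]setTI; exact: measurable_tcons.
- apply/trivIsetP => /= i j _ _ ij; rewrite -preimage_setI.
  by move/trivIsetP : tF => /(_ _ _ _ _ ij) ->//; rewrite preimage_set0.
- rewrite -preimage_bigcup -[X in measurable X]setTI.
  exact: measurable_tcons.
Qed.

HB.instance Definition _ := isMeasure.Build _ _ _ cons_measure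
  cons_measure_set0 cons_measure_ge0 cons_measure_sigma_additive.

Let cons_measure_sigma_finite : sigma_finite setT cons_measure.
Proof.
have /sigma_finiteP[F [TF ndF Foo]] := sigma_finiteT m1.
have /sigma_finiteP[G [TG ndG Goo]] := sigma_finiteT m2.
pose u (t : n.+1.-tuple T) : T * n.-tuple T := (thead t, [tuple of behead t]).
have uK x : u (tcons x) = x.
  by case: x => a b; rewrite /u /tcons /=; congr (_, _); apply/val_inj.
have measurable_u : measurable_fun setT u.
  apply/measurable_fun_pair => /=; first exact: measurable_tnth.
  exact: measurable_behead.
exists (fun k => u @^-1` (F k `*` G k)).
  apply/seteqP; split => // t _.
  have [k _ Fk] : (\bigcup_k F k) (u t).1 by rewrite -TF.
  have [l _ Gl] : (\bigcup_k G k) (u t).2 by rewrite -TG.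
  exists (maxn k l) => //; split.
  - by move: Fk; exact/subsetPset/ndF/leq_maxl.
  - by move: Gl; exact/subsetPset/ndG/leq_maxr.
move=> k; have [mF Fk] := Foo k; have [mG Gk] := Goo k; split.
  by rewrite -[X in measurable X]setTI; apply: measurable_u => //;
     exact: measurableX.
rewrite /cons_measure /pushforward -comp_preimage.
rewrite (_ : u \o tcons = id); last by apply/funext => x /=; rewrite uK.
by rewrite preimage_id product_measure1E// lte_mul_pinfty// ge0_fin_numE.
Qed.

HB.instance Definition _ := Measure_isSigmaFinite.Build _ _ _ cons_measure
  cons_measure_sigma_finite.

End cons_measure.

Section product_measure.
Context {d : measure_display} {T : measurableType d} {R : realType}.

Fixpoint tuple_measure (n : nat) :
    ('I_n -> {sigma_finite_measure set T -> \bar R}) ->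
    {sigma_finite_measure set (n.-tuple T) -> \bar R} :=
  match n with
  | 0 => fun=> dirac [tuple]
  | n'.+1 => fun m => cons_measure (m ord0) (tuple_measure (m \o lift ord0))
  end.

Lemma tuple_measureE (n : nat)
    (m : 'I_n -> {sigma_finite_measure set T -> \bar R}) (A : 'I_n -> set T) :
  (forall i, measurable (A i)) ->
  tuple_measure m [set t | forall i, A i (tnth t i)] =
    (\prod_(i < n) m i (A i))%E.
Proof.
elim: n m A => [|n IHn] m A mA /=.
  by rewrite big_ord0 diracE mem_set// => -[].
rewrite big_ord_recl -IHn; last by move=> i; exact: mA.
have mB : measurable [set t : n.-tuple T | forall i, A (lift ord0 i) (tnth t i)].
  rewrite (_ : mkset _ = \bigcap_(i in [set: 'I_n])
    ((@tnth _ T ^~ i) @^-1` A (lift ord0 i))); last first.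
    by apply/seteqP; split => t /= tA i; [move=> _|]; exact: tA.
  apply: fin_bigcap_measurable => // i _.
  by rewrite -[X in measurable X]setTI; exact: measurable_tnth.
rewrite -product_measure1E//; congr ((_ \x _)%E _).
apply/seteqP; split => [[a b] /= tA|[a b] /= [aA bA] i].
- split; first by have := tA ord0.
  by move=> i; have := tA (lift ord0 i); rewrite tnthS.
- by have [j ->|->] := unliftP ord0 i; rewrite ?tnthS//; exact: bA.
Qed.

End product_measure.

(* R^n, as tuples carrying the product of the Borel sigma-algebras of R. *)
Notation Rn R n := (n.-tuple (measurableTypeR R)).

Section Rn_vectors.
Context {R : realType} {n : nat}.

Definition tcol (t : Rn R n) : 'cV[R]_n := \col_i (tnth t i : R).

Definition coltuple (v : 'cV[R]_n) : Rn R n := [tuple v i 0 | i < n].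

Lemma tcolK : cancel tcol coltuple.
Proof. by move=> t; apply: eq_from_tnth => i; rewrite tnth_mktuple mxE. Qed.

Lemma coltupleK : cancel coltuple tcol.
Proof. by move=> v; apply/colP => i; rewrite mxE tnth_mktuple. Qed.

Definition lebesgue_Rn : {sigma_finite_measure set (Rn R n) -> \bar R} :=
  tuple_measure (fun=> lebesgue_measure).

(* The Gaussian law N(0, diag(v_1, .., v_n)), v_i > 0, as the law of a vector
   of independent N(0, v_i) coordinates; the second parameter of [normal_prob]
   is the standard deviation. *)
Definition diag_normal (v : 'cV[R]_n) :
    {sigma_finite_measure set (Rn R n) -> \bar R} :=
  tuple_measure (fun i => normal_prob 0 (Num.sqrt (v i 0))).

Definition is_density (P : set (Rn R n) -> \bar R) (f : Rn R n -> R) : Prop :=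
  [/\ measurable_fun setT f,
      forall y, 0 <= f y &
      forall A, measurable A -> P A = (\int[lebesgue_Rn]_(y in A) (f y)%:E)%E].

Definition psd (A : 'M[R]_n) : Prop :=
  A^T = A /\ forall v : 'cV[R]_n, 0 <= (v^T *m A *m v) 0 0.

End Rn_vectors.

Definition loewner_ge {R : realType} {n : nat} (A B : 'M[R]_n) : Prop :=
  psd (A - B).

Section model.
Context {R : realType} {N L : nat}.
Variables (Phi : 'M[R]_(N, L)) (sigma2 : R).

Definition positive_orthant : set 'cV[R]_L := [set g | forall i, 0 < g i 0].

(* The law of y = Phi x + n for independent x ~ N(0, diag(gamma)) and
   n ~ N(0, sigma2 I). *)
Definition observation_law (g : 'cV[R]_L) : set (Rn R N) -> \bar R :=
  pushforward (diag_normal g \x diag_normal (const_mx sigma2 : 'cV[R]_N))%E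
    (fun xn => coltuple (Phi *m tcol xn.1 + tcol xn.2)).

(* A density is determined only up to null sets, while derivatives in gamma
   need a pointwise choice of it for each gamma: p(.; gamma) is the unique
   continuous version. *)
Definition marginal_density (p : 'cV[R]_L -> Rn R N -> R) : Prop :=
  forall g, g \in positive_orthant ->
    is_density (observation_law g) (p g) /\ continuous (p g \o coltuple).

Definition Sigma_y (g : 'cV[R]_L) : 'M[R]_N :=
  sigma2%:M + Phi *m diag_mx g^T *m Phi^T.

End model.

Section estimation.
Context {R : realType} {N L : nat}.
Variable p : 'cV[R]_L -> Rn R N -> R.

Definition expectation_Y (g : 'cV[R]_L) (f : Rn R N -> R) : \bar R :=
  (\int[lebesgue_Rn]_y (f y * p g y)%:E)%E.

Definition integrable_Y (g : 'cV[R]_L) (f : Rn R N -> R) : Prop :=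
  lebesgue_Rn.-integrable setT (fun y => (f y * p g y)%:E).

Definition log_lik (y : Rn R N) (g : 'cV[R]_L) : R := ln (p g y).

Definition score (j : 'I_L) (y : Rn R N) (g : 'cV[R]_L) : R :=
  'D_(delta_mx j 0) (log_lik y) g.

Definition log_lik_hess (i j : 'I_L) (y : Rn R N) (g : 'cV[R]_L) : R :=
  'D_(delta_mx i 0) (score j y) g.

(* [fine] reads a finite extended real as a real; it is meaningful for the
   entries that are integrable in the sense of [integrable_Y]. *)
Definition fisher (g : 'cV[R]_L) : 'M[R]_L :=
  \matrix_(i, j) (- fine (expectation_Y g (log_lik_hess i j ^~ g))).

Definition sq_error (est : Rn R N -> Rn R L) (g : 'cV[R]_L) (y : Rn R N) :
    'M[R]_L :=
  (g - tcol (est y)) *m (g - tcol (est y))^T.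

Definition mse (est : Rn R N -> Rn R L) (g : 'cV[R]_L) : 'M[R]_L :=
  \matrix_(i, j) fine (expectation_Y g (fun y => sq_error est g y i j)).

Definition admissible (est : Rn R N -> Rn R L) : Prop :=
  forall g, g \in positive_orthant ->
    (forall i j, integrable_Y g (fun y => sq_error est g y i j)) /\
    (forall i, expectation_Y g (fun y => tcol (est y) i 0) = (g i 0)%:E).

End estimation.

(* Main.v *)
(** The density of [y = Phi x + n] is obtained by integrating out [x]: the
    exponent is quadratic in [x], and the Woodbury identity turns the result
    into the centred Gaussian density of covariance [Sigma_y]; continuity makes
    this hold pointwise. A change of one [gamma_j] is a rank-one perturbation of
    [Sigma_y], so the Sherman-Morrison formula and the first-order expansion of
    the determinant give the score and the Hessian, which are quadratic in [y];
    their expectations only need [E[y y^T] = Sigma_y].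

    The bound is the limit of the Hammersley-Chapman-Robbins inequality along
    [gamma + t a] as [t -> 0]. This avoids differentiating under the integral
    sign, because the chi-square divergence between two centred Gaussian laws of
    covariances [S + t D] and [S] is exactly
    [det (1 - t^2 (S^-1 D)^2) ^ (-1/2) - 1], and the trace of [(S^-1 D)^2] is
    twice the Fisher quadratic form at [a]. *)

Require Import Defs.
From HB Require Import structures.
From mathcomp Require Import all_boot all_order all_algebra.
From mathcomp Require Import all_classical all_reals all_analysis.
From mathcomp Require Import measurable_realfun.
From mathcomp Require Import ring lra.

Set Implicit Arguments.
Unset Strict Implicit.
Unset Printing Implicit Defensive.

Import Order.TTheory GRing.Theory Num.Theory.
Import numFieldNormedType.Exports.

Local Open Scope classical_set_scope.
Local Open Scope ring_scope.

(** * Bilinear forms and positive definite matrices *)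

(** All integrals reduce to one computation, that of [exp (- Q / 2)] for a positive definite form
    [Q] on tuples. It goes by induction on the dimension: the head is integrated out after
    completing the square, and the Schur complement is the form left on the tail, so that Tonelli
    and translation invariance replace diagonalization and general changes of variables.

    One algebraic fact, [det (1 - s B) = 1 - s tr B + O(s^2)], serves for the score, for the second
    moments and for the limit of the chi-square divergence. It reaches the second moments because
    the expectation of [exp (- s (a.y)^2 / 2)] is a determinant to the power [-1/2], whose
    derivative at [s = 0] is [- E[(a.y)^2] / 2].

    The chi-square integral is finite only when [S - t D] is positive definite along with [S + t D];
    for this reason [gamma - t a] has to stay in the orthant together with [gamma + t a]. *)

Section bilinear_form.
Context {R : comNzRingType}.
Implicit Types m n : nat.

Definition bilin m n (A : 'M[R]_(m, n)) (x : 'cV[R]_m) (y : 'cV[R]_n) : R :=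
  (x^T *m A *m y) 0 0.

Lemma bilinDl m n (A : 'M[R]_(m, n)) x1 x2 y :
  bilin A (x1 + x2) y = bilin A x1 y + bilin A x2 y.
Proof. by rewrite /bilin linearD/= !mulmxDl mxE. Qed.

Lemma bilinDr m n (A : 'M[R]_(m, n)) x y1 y2 :
  bilin A x (y1 + y2) = bilin A x y1 + bilin A x y2.
Proof. by rewrite /bilin mulmxDr mxE. Qed.

Lemma bilinDm m n (A B : 'M[R]_(m, n)) x y :
  bilin (A + B) x y = bilin A x y + bilin B x y.
Proof. by rewrite /bilin mulmxDr mulmxDl mxE. Qed.

Lemma bilinZl m n (A : 'M[R]_(m, n)) a x y :
  bilin A (a *: x) y = a * bilin A x y.
Proof. by rewrite /bilin linearZ/= -!scalemxAl mxE. Qed.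

Lemma bilinZr m n (A : 'M[R]_(m, n)) a x y :
  bilin A x (a *: y) = a * bilin A x y.
Proof. by rewrite /bilin -scalemxAr mxE. Qed.

Lemma bilinZm m n (A : 'M[R]_(m, n)) a x y :
  bilin (a *: A) x y = a * bilin A x y.
Proof. by rewrite /bilin -scalemxAr -scalemxAl mxE. Qed.

Lemma bilinNm m n (A : 'M[R]_(m, n)) x y : bilin (- A) x y = - bilin A x y.
Proof. by rewrite -scaleN1r bilinZm mulN1r. Qed.

Lemma bilinNl m n (A : 'M[R]_(m, n)) x y : bilin A (- x) y = - bilin A x y.
Proof. by rewrite -scaleN1r bilinZl mulN1r. Qed.

Lemma bilinNr m n (A : 'M[R]_(m, n)) x y : bilin A x (- y) = - bilin A x y.
Proof. by rewrite -scaleN1r bilinZr mulN1r. Qed.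

Lemma bilin_mul m n k l (A : 'M[R]_(k, l)) (B : 'M[R]_(k, m))
    (C : 'M[R]_(l, n)) x y :
  bilin (B^T *m A *m C) x y = bilin A (B *m x) (C *m y).
Proof. by rewrite /bilin trmx_mul !mulmxA. Qed.

Lemma bilin_sum m n (A : 'M[R]_(m, n)) x y :
  bilin A x y = \sum_i \sum_j x i 0 * A i j * y j 0.
Proof.
rewrite /bilin mxE exchange_big/=; apply: eq_bigr => j _.
by rewrite mxE mulr_suml; apply: eq_bigr => i _; rewrite mxE.
Qed.

Lemma bilin1 n (x y : 'cV[R]_n) : bilin 1%:M x y = \sum_i x i 0 * y i 0.
Proof. by rewrite /bilin mulmx1 mxE; apply: eq_bigr => i _; rewrite mxE. Qed.

Lemma bilin_diag n (d : 'rV[R]_n) x y :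
  bilin (diag_mx d) x y = \sum_i d 0 i * (x i 0 * y i 0).
Proof.
rewrite /bilin mxE; apply: eq_bigr => i _.
by rewrite mul_mx_diag !mxE mulrAC mulrA [d 0 i * _]mulrC mulrAC.
Qed.

Lemma bilinT m n (A : 'M[R]_(m, n)) x y : bilin A^T x y = bilin A y x.
Proof.
transitivity ((x^T *m A^T *m y)^T 0 0); first by rewrite mxE.
by rewrite !trmx_mul !trmxK mulmxA.
Qed.

Lemma bilin_sym n (A : 'M[R]_n) : A^T = A ->
  forall x y, bilin A x y = bilin A y x.
Proof. by move=> AT x y; rewrite -{1}AT bilinT. Qed.

Lemma bilin_outer m n (u x : 'cV[R]_m) (v y : 'cV[R]_n) :
  bilin (u *m v^T) x y = bilin 1%:M u x * bilin 1%:M v y.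
Proof.
rewrite /bilin !mulmx1 mulmxA -mulmxA mxE big_ord1; congr (_ * _).
by rewrite !mxE; apply: eq_bigr => i _; rewrite !mxE mulrC.
Qed.

Lemma bilin_mxtrace n (A : 'M[R]_n) x y : bilin A x y = \tr (A *m (y *m x^T)).
Proof.
by rewrite mulmxA mxtrace_mulC mulmxA [X in \tr X]mx11_scalar mxtrace_scalar.
Qed.

End bilinear_form.

Section positive_definite.
Context {R : realFieldType}.
Implicit Types n : nat.

Definition pdmx n (A : 'M[R]_n) : Prop :=
  A^T = A /\ forall v : 'cV[R]_n, v != 0 -> 0 < bilin A v v.

Lemma pdmx_unit n (A : 'M[R]_n) : pdmx A -> A \in unitmx.
Proof.
case=> AT Apos; rewrite -row_free_unit -kermx_eq0; apply/eqP/row_matrixP => i.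
rewrite row0; apply/eqP; apply: contraT => ri0.
have := Apos (row i (kermx A))^T.
rewrite /bilin trmxK -row_mul mulmx_ker row0 mul0mx mxE ltxx.
rewrite -(inj_eq (can_inj (@trmxK _ _ _))) trmxK trmx0 => /(_ ri0).
by [].
Qed.

Lemma pdmx_inv n (A : 'M[R]_n) : pdmx A -> pdmx (invmx A).
Proof.
move=> pA; have uA := pdmx_unit pA; case: pA => AT Apos.
split=> [|v v0]; first by rewrite trmx_inv AT.
have -> : invmx A = (invmx A)^T *m A *m invmx A.
  by rewrite trmx_inv AT mulVmx// mul1mx.
rewrite bilin_mul; apply: Apos; apply: contraNneq v0 => v0.
by rewrite -[v](mulKVmx uA) v0 mulmx0.
Qed.

Lemma pdmx_scalar n (a : R) : 0 < a -> pdmx (a%:M : 'M[R]_n).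
Proof.
move=> a0; split=> [|v v0]; first exact: tr_scalar_mx.
rewrite -scalemx1 bilinZm bilin1 pmulr_rgt0//.
rewrite lt_def sumr_ge0 ?andbT; last by move=> i _; rewrite -expr2 sqr_ge0.
apply: contraNneq v0 => /eqP.
rewrite psumr_eq0; last by move=> i _; rewrite -expr2 sqr_ge0.
move=> /allP v0; apply/eqP/colP => i; rewrite mxE.
by have /= := v0 i (mem_index_enum i); rewrite mulf_eq0 orbb => /eqP.
Qed.

Lemma pdmx_diag n (d : 'rV[R]_n) : (forall i, 0 < d 0 i) -> pdmx (diag_mx d).
Proof.
move=> d0; split=> [|v v0]; first exact: tr_diag_mx.
rewrite bilin_diag lt_def sumr_ge0 ?andbT; last first.
  by move=> i _; rewrite mulr_ge0// ?(ltW (d0 _))// -expr2 sqr_ge0.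
apply: contraNneq v0 => /eqP.
rewrite psumr_eq0; last by move=> i _; rewrite mulr_ge0// ?(ltW (d0 _))// -expr2 sqr_ge0.
move=> /allP v0; apply/eqP/colP => i; rewrite mxE.
have /= := v0 i (mem_index_enum i).
by rewrite mulf_eq0 gt_eqF//= mulf_eq0 orbb => /eqP.
Qed.

Lemma pdmxD n (A B : 'M[R]_n) : pdmx A -> B^T = B ->
  (forall v, 0 <= bilin B v v) -> pdmx (A + B).
Proof.
move=> [AT Apos] BT Bpos; split=> [|v v0]; first by rewrite linearD/= AT BT.
by rewrite bilinDm ltr_pwDl// Apos.
Qed.

Lemma pdmx_ge0 n (A : 'M[R]_n) v : pdmx A -> 0 <= bilin A v v.
Proof.
case=> _ Apos; have [->|/Apos/ltW//] := eqVneq v 0.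
by rewrite /bilin mulmx0 mxE.
Qed.

Lemma pdmx_congr n (A B : 'M[R]_n) : B \in unitmx -> pdmx A ->
  pdmx (B^T *m A *m B).
Proof.
move=> uB [AT Apos]; split=> [|v v0].
  by rewrite !trmx_mul trmxK AT mulmxA.
rewrite bilin_mul; apply: Apos; apply: contraNneq v0 => v0.
by rewrite -[v](mulKmx uB) v0 mulmx0.
Qed.

(** The lower-left column stands for both off-diagonal blocks, so this is the Schur complement of
    the corner entry when [A] is symmetric. *)
Definition schur n (A : 'M[R]_(1 + n)) : 'M[R]_n :=
  drsubmx A - (A 0 0)^-1 *: (dlsubmx A *m (dlsubmx A)^T).

(** The head [x] appears only in one square, whose centre depends on [s] and whose coefficient does
    not: integrating over [x] gives a constant and leaves the Schur complement. *)
Lemma complete_square n (A : 'M[R]_(1 + n)) (x : R) (s : 'cV[R]_n) :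
  A^T = A -> A 0 0 != 0 ->
  bilin A (col_mx x%:M s) (col_mx x%:M s) =
  A 0 0 * (x + (A 0 0)^-1 * bilin 1%:M (dlsubmx A) s) ^+ 2 +
  bilin (schur A) s s.
Proof.
move=> AT a0; have uT : ursubmx A = (dlsubmx A)^T by rewrite -{1}AT -trmx_dlsub.
have ul : ulsubmx A = (A 0 0)%:M.
  by rewrite [LHS]mx11_scalar !mxE; congr (A _ _)%:M; exact/val_inj.
have -> : bilin A (col_mx x%:M s) (col_mx x%:M s) =
    A 0 0 * x ^+ 2 + x * bilin 1%:M (dlsubmx A) s * 2 + bilin (drsubmx A) s s.
  rewrite {1}/bilin -{1}[A]submxK tr_col_mx mul_row_block mul_row_col ul uT.
  have e1 : (dlsubmx A)^T *m s = (bilin 1%:M (dlsubmx A) s)%:M.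
    by rewrite [LHS]mx11_scalar /bilin mulmx1.
  have e2 : s^T *m dlsubmx A = (bilin 1%:M (dlsubmx A) s)%:M.
    by rewrite -[RHS]tr_scalar_mx -e1 trmx_mul trmxK.
  rewrite tr_scalar_mx !mulmxDl e2 -[x%:M *m _ *m s]mulmxA e1 -!scalar_mxM.
  have -> : s^T *m drsubmx A *m s = (bilin (drsubmx A) s s)%:M.
    exact: mx11_scalar.
  by rewrite !mxE !mulr1n; ring.
rewrite /schur bilinDm bilinNm bilinZm bilin_outer.
by field.
Qed.

(** Block elimination: [A] is a unit lower triangular matrix times an upper triangular one with
    diagonal blocks [A 0 0] and [schur A]. *)
Lemma det_schur n (A : 'M[R]_(1 + n)) :
  A^T = A -> A 0 0 != 0 -> \det A = A 0 0 * \det (schur A).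
Proof.
move=> AT a0; have uT : ursubmx A = (dlsubmx A)^T by rewrite -{1}AT -trmx_dlsub.
have ul : ulsubmx A = (A 0 0)%:M.
  by rewrite [LHS]mx11_scalar !mxE; congr (A _ _)%:M; exact/val_inj.
have defA : A = block_mx 1%:M 0 ((A 0 0)^-1 *: dlsubmx A) 1%:M *m
              block_mx (A 0 0)%:M (dlsubmx A)^T 0 (schur A).
  rewrite mulmx_block !mul1mx !mul0mx !addr0.
  rewrite mul_mx_scalar scalerA divff// scale1r -scalemxAl addrC subrK.
  by rewrite -uT -ul submxK.
by rewrite {1}defA det_mulmx det_lblock det_ublock !det1 !mul1r det_scalar1.
Qed.

Lemma pdmx_corner_gt0 n (A : 'M[R]_(1 + n)) : pdmx A -> 0 < A 0 0.
Proof.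
case=> _ Apos; have := Apos (delta_mx 0 0); rewrite /bilin.
rewrite trmx_delta -rowE -colE !mxE; apply.
apply/eqP => /colP/(_ 0); rewrite !mxE eqxx => /eqP.
by rewrite oner_eq0.
Qed.

Lemma pdmx_schur n (A : 'M[R]_(1 + n)) : pdmx A -> pdmx (schur A).
Proof.
move=> pA; have a0 := pdmx_corner_gt0 pA; case: pA => AT Apos; split.
  rewrite /schur linearB/= linearZ/= trmx_mul trmxK trmx_drsub AT.
  by [].
(* This head cancels the completed square, so the form of [A] at the extended vector is that of the
   Schur complement at [v]. *)
move=> v v0; pose x : R := - ((A 0 0)^-1 * bilin 1%:M (dlsubmx A) v).
have := Apos (col_mx x%:M v).
rewrite complete_square// ?gt_eqF// /x addNr expr0n mulr0 add0r; apply.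
apply: contraNneq v0 => h; apply/eqP.
by rewrite -[v](col_mxKd (x%:M : 'M[R]_1)) h linear0.
Qed.

Lemma pdmx_det_gt0 n (A : 'M[R]_n) : pdmx A -> 0 < \det A.
Proof.
elim: n A => [|n IHn] A pA; first by rewrite det_mx00.
rewrite (@det_schur n)//; last 2 first.
- by case: pA.
- by rewrite gt_eqF// (@pdmx_corner_gt0 n).
by rewrite mulr_gt0 ?(@pdmx_corner_gt0 n)// IHn//; exact: pdmx_schur.
Qed.

(* Evaluating the characteristic polynomial of [B] at [1/s]. *)
Lemma det_perturb n (B : 'M[R]_n) :
  exists r : {poly R}, forall s,
    \det (1%:M - s *: B) = 1 - s * \tr B + s ^+ 2 * r.[s].
Proof.
case: n B => [|n] B.
  by exists 0 => s; rewrite det_mx00 /mxtrace big_ord0 horner0 !mulr0 subr0 addr0.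
(* [B] has size [n.+1], so the coefficient of degree [n.-1 - i] is multiplied by [s ^+ i.+2], of
   which [s ^+ 2] is factored out. The two top coefficients give [1 - s * \tr B]. *)
exists (\poly_(i < n) (char_poly B)`_(n.-1 - i)) => s.
have [->|s0] := eqVneq s 0.
  by rewrite scale0r subr0 det1 mul0r expr0n mul0r addr0 subr0.
have -> : 1%:M - s *: B = s *: (s^-1%:M - B).
  by rewrite scalerBr scale_scalar_mx mulfV.
rewrite detZ.
have -> : \det (s^-1%:M - B) = (char_poly B).[s^-1].
  rewrite -[RHS]/(horner_eval s^-1 _) /char_poly -det_map_mx; congr (\det _).
  by apply/matrixP => i j; rewrite !mxE/= /horner_eval !hornerE hornerMn hornerX.
rewrite horner_coef size_char_poly mulr_sumr big_ord_recr/= big_ord_recr/=.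
have -> : (char_poly B)`_n.+1 = 1.
  by have /monicP := char_poly_monic B; rewrite /lead_coef size_char_poly.
have -> : (char_poly B)`_n = - \tr B by rewrite -char_poly_trace.
rewrite mul1r -exprMn divff// expr1n addrC.
rewrite [X in 1 + X = _]addrC addrA.
congr (1 + _ + _).
  by rewrite exprS mulrCA -!mulrA -exprMn divff// expr1n !mulr1 mulNr mulrC.
rewrite horner_poly mulr_sumr (reindex_inj rev_ord_inj)/=.
apply: eq_bigr => i _.
have le : (n - i.+1 <= n.+1)%N by rewrite (leq_trans (leq_subr _ _)).
have -> : (n.-1 - i = n - i.+1)%N by rewrite -subn1 -subnDA add1n.
rewrite mulrCA exprVn -expfB ?(leq_ltn_trans (leq_subr _ _))//.
rewrite [RHS]mulrCA -exprD; congr (_ * _ ^+ _).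
by rewrite subSn ?leq_subr// subKn// addnC addn2.
Qed.

(* Sherman--Morrison. *)
Lemma bilin_inv_rank1 n (S : 'M[R]_n) (u x y : 'cV[R]_n) t :
  S \in unitmx -> S + t *: (u *m u^T) \in unitmx ->
  1 + t * bilin (invmx S) u u != 0 ->
  bilin (invmx (S + t *: (u *m u^T))) x y = bilin (invmx S) x y -
    t * (bilin (invmx S) x u * bilin (invmx S) u y)
      / (1 + t * bilin (invmx S) u u).
Proof.
move=> uS uSt d0; set d := 1 + _ in d0 *.
have -> : invmx (S + t *: (u *m u^T)) =
    invmx S - (t / d) *: (invmx S *m u *m (u^T *m invmx S)).
  apply: (can_inj (mulKmx uSt)); rewrite mulmxV//; apply/esym.
  set w := invmx S *m u; set w' := u^T *m invmx S.
  have Sww : S *m (w *m w') = u *m w' by rewrite mulmxA mulKVmx.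
  have uww : u *m u^T *m (w *m w') = bilin (invmx S) u u *: (u *m w').
    rewrite -mulmxA [u^T *m (w *m w')]mulmxA [u^T *m w]mx11_scalar.
    by rewrite mul_scalar_mx -scalemxAr /bilin -mulmxA.
  have uuS : u *m u^T *m invmx S = u *m w' by rewrite mulmxA.
  rewrite mulmxBr mulmxDl mulmxV// -scalemxAl uuS -scalemxAr mulmxDl Sww.
  rewrite -scalemxAl uww scalerA scalerDr scalerA -scalerDl -addrA -scalerBl.
  rewrite (_ : t - _ = 0) ?scale0r ?addr0; last first.
    rewrite -{1}[t](divfK d0).
    by rewrite /d; ring.
  by [].
rewrite bilinDm bilinNm bilinZm; congr (_ - _).
rewrite mulrAC; congr (_ * _ / _).
by rewrite {1}/bilin !mulmxA -[_ *m u^T *m _]mulmxA -[_ *m (_ *m _) *m _]mulmxA mxE big_ord1.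
Qed.

Lemma bilin_invmx n (A : 'M[R]_n) (a y : 'cV[R]_n) : A^T = A ->
  bilin (invmx A) a y = bilin 1%:M (invmx A *m a) y.
Proof. by move=> AT; rewrite /bilin mulmx1 trmx_mul trmx_inv AT. Qed.

Lemma invmx_woodbury n m (Phi : 'M[R]_(n, m)) (G : 'M[R]_m) (s : R)
    (S := s%:M + Phi *m G *m Phi^T)
    (Q := invmx G + s^-1 *: (Phi^T *m Phi)) :
  s != 0 -> G \in unitmx -> Q \in unitmx -> S \in unitmx ->
  invmx S = s^-1%:M - s ^- 2 *: (Phi *m invmx Q *m Phi^T).
Proof.
move=> s0 uG uQ uS; apply: (can_inj (mulKmx uS)); rewrite mulmxV//; apply/esym.
set E := Phi *m invmx Q *m Phi^T; pose T := Phi *m G *m Phi^T.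
(* This relation is all that is needed: expanding [(s + T) (s^-1 - s^-2 E)] with it leaves the
   identity. It follows from [G Phi^T Phi = s (G Q - 1)], which is the definition of [Q]. *)
have TE : T *m E = s *: (T - E).
  have -> : T *m E = Phi *m (G *m (Phi^T *m Phi)) *m invmx Q *m Phi^T.
    by rewrite !mulmxA.
  have -> : G *m (Phi^T *m Phi) = s *: (G *m Q - 1%:M).
    rewrite /Q mulmxDr mulmxV// -scalemxAr addrC addKr scalerA.
    by rewrite divff// scale1r.
  rewrite -!(scalemxAl, scalemxAr) mulmxBr mulmx1 !mulmxBl; congr (_ *: (_ - _)).
  by rewrite mulmxA -[_ *m Q *m _]mulmxA mulmxV// mulmx1.
rewrite -[S]/(s%:M + T) mulmxBr !mulmxDl -!scalemxAr TE !mul_mx_scalar.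
rewrite mul_scalar_mx scale_scalar_mx mulVf// !scalerDr !scalerA !scalerN.
rewrite (_ : s ^- 2 * s = s^-1); last by field.
by rewrite [X in _ - X]addrC subrK addrK.
Qed.

End positive_definite.

(** * Integration on products *)

Section cons_measure_integral.
Context {d : measure_display} {T : measurableType d} {R : realType} (n : nat).
Variables (m1 : {sigma_finite_measure set T -> \bar R})
  (m2 : {sigma_finite_measure set (n.-tuple T) -> \bar R}).
Variable f : n.+1.-tuple T -> \bar R.
Hypotheses (mf : measurable_fun setT f) (f0 : forall t, (0 <= f t)%E).

Lemma integral_cons_measure1 :
  (\int[cons_measure m1 m2]_t f t =
   \int[m1]_x \int[m2]_s f (tcons (x, s)))%E.
Proof.
rewrite [LHS](ge0_integral_pushforward (@measurable_tcons _ _ _))//.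
rewrite preimage_setT (fubini_tonelli1 (f \o @tcons _ T n))//=.
exact: (measurableT_comp mf (@measurable_tcons _ _ _)).
Qed.

(** The order with the head innermost is the one in which the Gaussian integral completes its
    square. *)
Lemma integral_cons_measure2 :
  (\int[cons_measure m1 m2]_t f t =
   \int[m2]_s \int[m1]_x f (tcons (x, s)))%E.
Proof.
rewrite [LHS](ge0_integral_pushforward (@measurable_tcons _ _ _))//.
rewrite preimage_setT (fubini_tonelli2 (f \o @tcons _ T n))//=.
exact: (measurableT_comp mf (@measurable_tcons _ _ _)).
Qed.

End cons_measure_integral.

Section density.
Context {d : measure_display} {T : measurableType d} {R : realType}.
Variables (mu nu : {measure set T -> \bar R}) (g : T -> R).
Hypotheses (mg : measurable_fun setT g) (g0 : forall x, 0 <= g x).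
Hypothesis nug : forall A, measurable A ->
  (nu A = \int[mu]_(x in A) (g x)%:E)%E.

Import HBNNSimple.

(** On level sets this is [nug]; linearity extends it to simple functions, and monotone convergence
    along the simple approximations of [f] does the rest. *)
Lemma ge0_integral_density (f : T -> \bar R) :
  measurable_fun setT f -> (forall x, (0 <= f x)%E) ->
  (\int[nu]_x f x = \int[mu]_x (f x * (g x)%:E))%E.
Proof.
move=> mf f0; have mgE : measurable_fun setT (EFin \o g).
  exact/measurable_EFinP.
pose h := nnsfun_approx measurableT mf.
have -> : (\int[nu]_x f x = limn (fun n => \int[nu]_x (h n x)%:E))%E.
  rewrite -monotone_convergence//.
  - apply: eq_integral => x _; apply/esym/cvg_lim => //.
    exact: cvg_nnsfun_approx.
  - by move=> n; exact/measurable_EFinP/measurable_funP.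
  - by move=> n x _; rewrite lee_fin.
  - by move=> x _ a b ab; rewrite lee_fin; exact/lefP/nd_nnsfun_approx.
have -> : (\int[mu]_x (f x * (g x)%:E) =
    limn (fun n => \int[mu]_x ((h n x)%:E * (g x)%:E)))%E.
  rewrite -monotone_convergence//.
  - apply: eq_integral => x _; apply/esym/cvg_lim => //.
    by apply: cvgeZr => //; exact: cvg_nnsfun_approx.
  - by move=> n; apply: emeasurable_funM => //; exact/measurable_EFinP.
  - by move=> n x _; rewrite mule_ge0// lee_fin.
  - move=> x _ a b ab; rewrite lee_wpmul2r ?lee_fin//.
    exact/lefP/nd_nnsfun_approx.
congr (limn _); apply/funext => n.
transitivity (\int[nu]_x
   (\sum_(y \in range (h n)) (y * \1_(h n @^-1` [set y]) x)%:E))%E.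
  by apply: eq_integral => t _; rewrite fimfunE -fsumEFin.
have mind r : measurable_fun setT (fun x => (r * \1_(h n @^-1` [set r]) x)%:E).
  by apply/measurable_EFinP; exact: measurable_funM.
rewrite ge0_integral_fsum//; last first.
  by move=> m y _; exact: nnfun_muleindic_ge0.
transitivity (\int[mu]_x (\sum_(y \in range (h n))
    (y * \1_(h n @^-1` [set y]) x)%:E * (g x)%:E))%E; last first.
  apply: eq_integral => x _.
  rewrite -ge0_mule_fsuml => [|y]; last exact: nnfun_muleindic_ge0.
  by rewrite fsumEFin // -(fimfunE _ x).
rewrite ge0_integral_fsum//; last 2 first.
- by move=> y; apply: emeasurable_funM.
- move=> m y _; apply: mule_ge0; last by rewrite lee_fin.
  exact: nnfun_muleindic_ge0.
apply: eq_fsbigr => r /set_mem[x _ <-].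
have mB : measurable (h n @^-1` [set h n x]) by [].
transitivity ((h n x)%:E * nu (h n @^-1` [set h n x]))%E.
  under eq_integral do rewrite EFinM.
  rewrite ge0_integralZl//; first by rewrite integral_indic// setIT.
  - exact/measurable_EFinP.
  - by rewrite lee_fin.
rewrite nug// integral_mkcond -ge0_integralZl//; last 3 first.
- by apply/(measurable_restrictT _ mB)/measurable_funTS.
- by move=> y _; rewrite patchE; case: ifP => // _; rewrite lee_fin.
- by rewrite lee_fin.
apply: eq_integral => y _; rewrite EFinM -muleA patchE indicE.
by case: (y \in _); rewrite ?mul1e// mul0e.
Qed.

End density.

Section tuple_measure_density.
Context {d : measure_display} {T : measurableType d} {R : realType}.

Lemma measurable_prod_tnth n (g : 'I_n -> T -> R) :
  (forall i, measurable_fun setT (g i)) ->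
  measurable_fun setT (fun t : n.-tuple T => \prod_i g i (tnth t i)).
Proof.
move=> mg; apply: measurable_prod => i _.
exact: measurableT_comp (mg i) (measurable_tnth i).
Qed.

(** The densities are given through the integration formula rather than through values on sets,
    since the induction applies that formula to the inner integral as a function of the head. *)
Lemma ge0_integral_tuple_measure_density n
    (m mu : 'I_n -> {sigma_finite_measure set T -> \bar R})
    (g : 'I_n -> T -> R) :
  (forall i, measurable_fun setT (g i)) -> (forall i x, 0 <= g i x) ->
  (forall i (f : T -> \bar R), measurable_fun setT f ->
    (forall x, (0 <= f x)%E) ->
    (\int[m i]_x f x = \int[mu i]_x (f x * (g i x)%:E))%E) ->
  forall f : n.-tuple T -> \bar R, measurable_fun setT f ->
    (forall x, (0 <= f x)%E) ->
  (\int[tuple_measure m]_t f t =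
   \int[tuple_measure mu]_t (f t * (\prod_i g i (tnth t i))%:E))%E.
Proof.
elim: n m mu g => [|n IHn] m mu g mg g0 mE f mf f0 /=.
  rewrite !integral_dirac// ?diracT ?mul1e ?big_ord0 ?mule1//.
  apply: emeasurable_funM => //; apply/measurable_EFinP.
  exact: measurable_prod_tnth.
have mtc (x : T) : measurable_fun setT (fun s : n.-tuple T => tcons (x, s)).
  exact: (measurableT_comp (@measurable_tcons _ _ _) (measurable_pair1 x)).
have mp := measurable_prod_tnth mg.
rewrite !integral_cons_measure1//; last 2 first.
- by apply: emeasurable_funM => //; exact/measurable_EFinP.
- by move=> t; rewrite mule_ge0// lee_fin prodr_ge0.
rewrite mE; last 2 first.
- apply: (@measurable_fun_fubini_tonelli_F _ _ _ _ _ _ (f \o @tcons _ T n)); last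
    by move=> x; exact: f0.
  exact: (measurableT_comp mf (@measurable_tcons _ _ _)).
- by move=> x; exact: integral_ge0.
apply: eq_integral => x _.
rewrite (IHn _ (mu \o lift ord0) (g \o lift ord0))//; last 4 first.
- by move=> i; exact: mg.
- by move=> i x'; exact: g0.
- by move=> i f' mf' f'0; exact: mE.
- exact: (measurableT_comp mf (mtc x)).
rewrite -ge0_integralZr//; last 3 first.
- apply: emeasurable_funM; first exact: (measurableT_comp mf (mtc x)).
  apply/measurable_EFinP.
  by apply: (@measurable_prod_tnth n (g \o lift ord0)) => i; exact: mg.
- by move=> s _; rewrite mule_ge0// lee_fin prodr_ge0// => i _; exact: g0.
- by rewrite lee_fin.
apply: eq_integral => s _; rewrite -muleA -EFinM big_ord_recl mulrC.
by congr (_ * (_ * _)%:E)%E; apply: eq_bigr => i _; rewrite tnthS.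
Qed.

End tuple_measure_density.

Section lebesgue_translation.
Context {R : realType}.
Notation mu := (@lebesgue_measure R).

(** The image of Lebesgue measure under the translation agrees with it on half-open intervals, which
    determines the measure. *)
Lemma ge0_integral_shift (f : measurableTypeR R -> \bar R) (a : R) :
  measurable_fun setT f -> (forall x, (0 <= f x)%E) ->
  (\int[mu]_x f ((x : R) + a)%R = \int[mu]_x f x)%E.
Proof.
move=> mf f0.
pose s : measurableTypeR R -> measurableTypeR R := fun x => (x : R) + a.
have ms : measurable_fun setT s by exact: measurable_funD.
rewrite -[LHS]/(\int[mu]_(x in s @^-1` setT) (f \o s) x)%E.
rewrite -(ge0_integral_pushforward ms)//; apply: eq_measure_integral => A mA _.
apply/esym/(@lebesgue_measure_unique _ (pushforward mu s)) => // X [[b c] _ <-].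
rewrite -[RHS]/(mu (s @^-1` `]b, c])).
have -> : s @^-1` `]b, c] = `]b - a, c - a]%classic.
  by apply/seteqP; split => x /=; rewrite !in_itv/= ltrBlDr lerBrDr.
rewrite !lebesgue_measure_itv/= !lte_fin ltrD2r.
by case: ifPn => // _; rewrite -!EFinB; congr EFin; ring.
Qed.

Definition shift_tuple n (c : 'I_n -> R) (t : Rn R n) : Rn R n :=
  [tuple (tnth t i : R) + c i | i < n].

Lemma measurable_shift_tuple n (c : 'I_n -> R) :
  measurable_fun setT (shift_tuple c).
Proof.
apply/measurable_fun_tnthP => i; apply: (eq_measurable_fun
  (fun t : Rn R n => (tnth t i : measurableTypeR R) + c i)) => [t _|].
  by rewrite /= tnth_mktuple.
by apply: measurable_funD => //; exact: measurable_tnth.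
Qed.

Lemma ge0_integral_shift_Rn n (c : 'I_n -> R) (f : Rn R n -> \bar R) :
  measurable_fun setT f -> (forall x, (0 <= f x)%E) ->
  (\int[lebesgue_Rn]_t f (shift_tuple c t) = \int[lebesgue_Rn]_t f t)%E.
Proof.
elim: n c f => [|n IHn] c f mf f0.
  by apply: eq_integral => t _; rewrite [shift_tuple c t]tuple0 [t]tuple0.
have mtc (x : R) : measurable_fun setT
    (fun s : Rn R n => tcons (x : measurableTypeR R, s)).
  exact: (measurableT_comp (@measurable_tcons _ _ _) (measurable_pair1 _)).
rewrite /lebesgue_Rn/= !integral_cons_measure1//; last first.
  exact: (measurableT_comp mf (measurable_shift_tuple c)).
rewrite -[RHS](@ge0_integral_shift _ (c ord0)); last 2 first.
- apply: (@measurable_fun_fubini_tonelli_F _ _ _ _ _ _ (f \o @tcons _ _ n)); last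
    by move=> x; exact: f0.
  exact: (measurableT_comp mf (@measurable_tcons _ _ _)).
- by move=> x; exact: integral_ge0.
apply: eq_integral => x _.
rewrite -[RHS](IHn (c \o lift ord0))//; last first.
  exact: (measurableT_comp mf (mtc _)).
apply: eq_integral => s _; congr f; apply: eq_from_tnth => i.
rewrite tnth_mktuple; have [j ->|->] := unliftP ord0 i.
  by rewrite !tnthS tnth_mktuple.
by [].
Qed.

End lebesgue_translation.

(** * Gaussian integrals *)

Section measurable_bilinear.
Context {R : realType}.

Lemma measurable_bilin d (T : measurableType d) m n (A : 'M[R]_(m, n))
    (u : T -> 'cV[R]_m) (v : T -> 'cV[R]_n) :
  (forall i, measurable_fun setT (fun t => u t i 0)) ->
  (forall i, measurable_fun setT (fun t => v t i 0)) ->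
  measurable_fun setT (fun t => bilin A (u t) (v t)).
Proof.
move=> mu mv; under eq_fun do rewrite bilin_sum.
apply: measurable_sum => i; apply: measurable_sum => j.
by apply: measurable_funM => //; apply: measurable_funM.
Qed.

Lemma measurable_tcol n i : measurable_fun setT (fun y : Rn R n => tcol y i 0).
Proof. by under eq_fun do rewrite mxE; exact: measurable_tnth. Qed.

Lemma measurable_mulmx_tcol m n (A : 'M[R]_(m, n)) i :
  measurable_fun setT (fun y : Rn R n => (A *m tcol y) i 0).
Proof.
under eq_fun do rewrite mxE.
by apply: measurable_sum => j; apply: measurable_funM => //; exact: measurable_tcol.
Qed.

Lemma measurable_coltuple d (T : measurableType d) n (u : T -> 'cV[R]_n) :
  (forall i, measurable_fun setT (fun t => u t i 0)) ->
  measurable_fun setT (fun t => coltuple (u t)).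
Proof.
move=> mu; apply/measurable_fun_tnthP => i.
by apply: eq_measurable_fun (mu i) => t _; rewrite /= tnth_mktuple.
Qed.

End measurable_bilinear.

Section gaussian_integral.
Context {R : realType}.
Notation mu := (@lebesgue_measure R).

(** Square roots of determinants and of [2 * pi] are kept as exponentials of half logarithms, so
    that identities between constants become linear identities between exponents. *)
Lemma sqrt_expR (x : R) : 0 < x -> Num.sqrt x = expR (2^-1 * ln x).
Proof. by move=> x0; rewrite -powR12_sqrt ?ltW// /powR gt_eqF. Qed.

Lemma ln2pi_gt0 : 0 < 2 * pi :> R.
Proof. by rewrite mulr_gt0// pi_gt0. Qed.

(** The integrand is the normal density of mean [- m] and variance [a^-1] without its peak factor,
    and that density has total mass [1]. *)
Lemma integral_gauss1 (a m : R) : 0 < a ->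
  (\int[mu]_x (expR (- 2^-1 * (a * ((x : R) + m) ^+ 2)))%:E =
   (expR (2^-1 * (ln (2 * pi) - ln a)))%:E)%E.
Proof.
move=> a0; pose s : R := (Num.sqrt a)^-1.
have s0 : s != 0 by rewrite gt_eqF// invr_gt0 sqrtr_gt0.
have s2 : s ^+ 2 = a^-1 by rewrite exprVn sqr_sqrtr ?ltW.
have peak : normal_peak s = expR (- 2^-1 * (ln (2 * pi) - ln a)).
  rewrite /normal_peak s2 sqrt_expR; last first.
    by rewrite pmulrn_lgt0// mulr_gt0 ?invr_gt0// pi_gt0.
  rewrite -mulrnAr -[pi *+ 2]mulr_natl lnM ?posrE ?invr_gt0// ?ln2pi_gt0//.
  by rewrite lnV ?posrE// -expRN; congr expR; ring.
have := integral_normal_pdf (- m) s.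
rewrite /normal_pdf (negbTE s0).
under eq_integral do rewrite EFinM.
rewrite ge0_integralZl//; last 3 first.
- by apply/measurable_EFinP; exact: (@measurable_normal_fun R).
- by move=> x _; rewrite lee_fin normal_fun_ge0.
- by rewrite lee_fin normal_peak_ge0.
rewrite peak => h.
have -> : (fun x : R => (expR (- 2^-1 * (a * (x + m) ^+ 2)))%:E) =
          (fun x => (normal_fun (- m) s x)%:E).
  apply/funext => x; rewrite /normal_fun s2 opprK; congr (expR _)%:E.
  by field; rewrite gt_eqF.
move: h; set I := (\int[mu]_x _)%E => h.
(* [I] is an extended real not yet known to be finite; it is isolated by multiplying with the
   inverse of the peak factor. *)
have : ((expR (2^-1 * (ln (2 * pi) - ln a)))%:E *
  ((expR (- 2^-1 * (ln (2 * pi) - ln a)))%:E * I) =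
  (expR (2^-1 * (ln (2 * pi) - ln a)))%:E)%E by rewrite h mule1.
by rewrite muleA -EFinM -expRD mulNr subrr expR0 mul1e.
Qed.

Lemma tcol_tcons n (x : R) (s : Rn R n) :
  tcol (tcons (x : measurableTypeR R, s)) = col_mx x%:M (tcol s).
Proof.
apply/colP => i; rewrite !mxE; case: splitP => j ij.
  by rewrite ord1 !mxE mulr1n (_ : i = ord0)//; apply/val_inj; rewrite /= ij ord1.
by rewrite mxE (_ : i = lift ord0 j) ?tnthS//; exact/val_inj.
Qed.

Lemma measurable_bilin_tcol n (A : 'M[R]_n) :
  measurable_fun setT (fun y : Rn R n => bilin A (tcol y) (tcol y)).
Proof. by apply: measurable_bilin; exact: measurable_tcol. Qed.

Lemma measurable_expR_bilin n (A : 'M[R]_n) a :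
  measurable_fun setT (fun y : Rn R n =>
    (expR (a * bilin A (tcol y) (tcol y)))%:E).
Proof.
apply/measurable_EFinP; apply: measurableT_comp => //.
by apply: measurable_funM => //; exact: measurable_bilin_tcol.
Qed.

Lemma integral_gauss n (Q : 'M[R]_n) : pdmx Q ->
  (\int[lebesgue_Rn]_y (expR (- 2^-1 * bilin Q (tcol y) (tcol y)))%:E =
   (expR (2^-1 * (n%:R * ln (2 * pi) - ln (\det Q))))%:E)%E.
Proof.
elim: n Q => [|n IHn] Q pQ.
  rewrite /lebesgue_Rn/= integral_dirac//; last exact: measurable_expR_bilin.
  by rewrite diracT mul1e bilin_sum big_ord0 det_mx00 ln1 mul0r subrr !mulr0.
pose Q' : 'M[R]_(1 + n) := Q; have a0 := pdmx_corner_gt0 pQ; set a := Q 0 0 in a0.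
rewrite /lebesgue_Rn/= integral_cons_measure2//; last exact: measurable_expR_bilin.
rewrite -/lebesgue_Rn.
(* For each tail [s] the head sees a translated one-variable Gaussian with coefficient [a], whose
   integral does not depend on [s]. *)
transitivity (\int[lebesgue_Rn]_s
   ((expR (2^-1 * (ln (2 * pi) - ln a)))%:E *
    (expR (- 2^-1 * bilin (schur Q') (tcol s) (tcol s)))%:E))%E.
  apply: eq_integral => s _.
  rewrite -(@integral_gauss1 a (a^-1 * bilin 1%:M (dlsubmx Q') (tcol s)))//.
  rewrite -ge0_integralZr//; last first.
    apply/measurable_EFinP; apply: measurableT_comp => //.
    apply: measurable_funM => //; apply: measurable_funM => //.
    by apply: measurable_funX; exact: measurable_funD.
  apply: eq_integral => x _; rewrite tcol_tcons.
  rewrite (@complete_square _ n)//; last 2 first.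
  - by case: pQ.
  - by rewrite gt_eqF.
  by rewrite -EFinM -expRD; congr (expR _)%:E; rewrite -/a; ring.
rewrite ge0_integralZl//; last exact: measurable_expR_bilin.
rewrite IHn; last exact: pdmx_schur.
rewrite -EFinM -expRD (@det_schur _ n Q)//; last 2 first.
- by case: pQ.
- by rewrite gt_eqF.
have d0 : 0 < \det (schur Q') by exact/pdmx_det_gt0/pdmx_schur.
rewrite -/Q' -/a [ln (a * _)]lnM ?posrE//.
by congr (expR _)%:E; rewrite -/a -natr1; ring.
Qed.

(* [y |-> - y^T Q y / 2 + b^T y] is a quadratic form centred at [Q^-1 b]. *)
Lemma integral_gauss_linear n (Q : 'M[R]_n) (b : 'cV[R]_n) : pdmx Q ->
  (\int[lebesgue_Rn]_y
     (expR (- 2^-1 * bilin Q (tcol y) (tcol y) + bilin 1%:M b (tcol y)))%:E =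
   (expR (2^-1 * (n%:R * ln (2 * pi) - ln (\det Q) + bilin (invmx Q) b b)))%:E)%E.
Proof.
move=> pQ; have QT : Q^T = Q by case: pQ.
pose m := invmx Q *m b.
rewrite -(@ge0_integral_shift_Rn _ _ (fun i => m i 0))//; last first.
  apply/measurable_EFinP; apply: measurableT_comp => //.
  apply: measurable_funD; last by apply: measurable_bilin => // i; exact: measurable_tcol.
  by apply: measurable_funM => //; exact: measurable_bilin_tcol.
transitivity (\int[lebesgue_Rn]_y
   ((expR (2^-1 * bilin (invmx Q) b b))%:E *
    (expR (- 2^-1 * bilin Q (tcol y) (tcol y)))%:E))%E.
  apply: eq_integral => y _.
  have -> : tcol (shift_tuple (fun i => m i 0) y) = tcol y + m.
    by apply/colP => i; rewrite [LHS]mxE tnth_mktuple [RHS]mxE [tcol y i 0]mxE.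
  rewrite -EFinM -expRD; congr (expR _)%:E.
  rewrite !(bilinDl, bilinDr) [bilin Q m _](bilin_sym QT).
  have Qm x : bilin Q x m = bilin 1%:M b x.
    rewrite (bilin_sym (trmx1 _ _)) /bilin -mulmxA mulKVmx ?pdmx_unit//.
    by rewrite mulmx1.
  have -> : bilin (invmx Q) b b = bilin 1%:M b m by rewrite /bilin mulmx1 mulmxA.
  by rewrite !Qm; field.
rewrite ge0_integralZl//; last exact: measurable_expR_bilin.
rewrite integral_gauss// -EFinM -expRD; congr (expR _)%:E; ring.
Qed.

End gaussian_integral.

(** * The density of the observations *)

Section continuous_functions.
Context {R : realType} {T : topologicalType}.

Lemma continuous_addf (f g : T -> R) :
  continuous f -> continuous g -> continuous (fun x => f x + g x).
Proof. by move=> cf cg x; exact: cvgD (cf x) (cg x). Qed.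

Lemma continuous_mulf (f g : T -> R) :
  continuous f -> continuous g -> continuous (fun x => f x * g x).
Proof. by move=> cf cg x; exact: cvgM (cf x) (cg x). Qed.

Lemma continuous_sumf (I : Type) (r : seq I) (f : I -> T -> R) :
  (forall i, continuous (f i)) -> continuous (fun x => \sum_(i <- r) f i x).
Proof.
move=> fc; elim: r => [|i r IHr].
  by under [X in continuous X]eq_fun do rewrite big_nil; exact: cst_continuous.
under [X in continuous X]eq_fun do rewrite big_cons.
exact: continuous_addf.
Qed.

End continuous_functions.

Section continuous_density.
Context {R : realType} {n : nat}.

Lemma continuous_bilin (A : 'M[R]_n) : continuous (fun v : 'cV[R]_n => bilin A v v).
Proof.
under [X in continuous X]eq_fun do rewrite bilin_sum.
apply: continuous_sumf => i; apply: continuous_sumf => j.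
apply: continuous_mulf; last exact: coord_continuous.
by apply: continuous_mulf; [exact: coord_continuous|exact: cst_continuous].
Qed.

(** The entrywise ball of columns, carried over to tuples: it links the topology, which lives on
    columns, with the measure, which lives on tuples. *)
Definition box (v : 'cV[R]_n) (e : R) : set (Rn R n) :=
  [set t | forall i, `]v i 0 - e, v i 0 + e[%classic (tnth t i : R)].

Lemma measurable_box v e : measurable (box v e).
Proof.
rewrite (_ : box v e = \bigcap_(i in [set: 'I_n])
    ((@tnth n (measurableTypeR R))^~ i @^-1` `]v i 0 - e, v i 0 + e[)); last first.
  by apply/seteqP; split => t /= tA i; [move=> _|]; exact: tA.
apply: fin_bigcap_measurable => // i _.
by rewrite -[X in measurable X]setTI; apply: measurable_tnth => //; exact: measurable_itv.
Qed.

Lemma lebesgue_Rn_box v e : 0 < e -> lebesgue_Rn (box v e) = ((2 * e) ^+ n)%:E.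
Proof.
move=> e0; rewrite [LHS](@tuple_measureE _ _ _ n (fun=> lebesgue_measure)
  (fun i => `]v i 0 - e, v i 0 + e[%classic)); last by move=> i; exact: measurable_itv.
transitivity (\prod_(i < n) (2 * e)%:E)%E.
  apply: eq_bigr => i _.
  rewrite -[LHS]/(lebesgue_measure [set` `]v i 0 - e, v i 0 + e[]).
  rewrite lebesgue_measure_itv/= lte_fin ltrD2l gtrN//.
  by rewrite -EFinB; congr EFin; ring.
by rewrite prodEFin prodr_const card_ord.
Qed.

(** If [p y < q y], continuity keeps a gap between [p] and [q] on a small box about [y]; the box has
    positive finite volume, so the integrals over it would differ. *)
Lemma continuous_density_le (p q : Rn R n -> R) :
  measurable_fun setT p -> measurable_fun setT q ->
  (forall y, 0 <= p y) -> (forall y, 0 <= q y) ->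
  continuous (p \o coltuple) -> continuous (q \o coltuple) ->
  (forall A, measurable A ->
    (\int[lebesgue_Rn]_(y in A) (p y)%:E = \int[lebesgue_Rn]_(y in A) (q y)%:E)%E) ->
  forall y, q y <= p y.
Proof.
move=> mp mq p0 q0 cp cq pq y; rewrite leNgt; apply/negP => pqy.
(* With a third of the gap, [p y + d < q y - d] still holds, and [q y - d] is positive, as the
   comparison with a constant requires. *)
pose v := tcol y; pose d := (q y - p y) / 3.
have d0 : 0 < d by rewrite divr_gt0// subr_gt0.
have pv : (p \o coltuple) v = p y by rewrite /= tcolK.
have qv : (q \o coltuple) v = q y by rewrite /= tcolK.
have /nbhs_ballP[e /= e0 eB] : \forall w \near v,
    (p \o coltuple) w < p y + d /\ q y - d < (q \o coltuple) w.
  near=> w; split.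
    near: w; apply: (cvgr_lt ((p \o coltuple) v)); first exact: cp.
    by rewrite pv ltrDl.
  near: w; apply: (cvgr_gt ((q \o coltuple) v)); first exact: cq.
  by rewrite qv ltrBlDr ltrDl.
have mB := measurable_box v e.
have B t : box v e t -> p t < p y + d /\ q y - d < q t.
  move=> tB; have := eB (tcol t); rewrite /= tcolK; apply; split=> // i j.
  rewrite ord1 /ball/= [tcol t i 0]mxE; have := tB i; rewrite /= in_itv/= => /andP[t1 t2].
  by rewrite ltr_norml; lra.
have mpE A : measurable_fun A (fun y => (p y)%:E).
  exact/measurable_funTS/measurable_EFinP.
have mqE A : measurable_fun A (fun y => (q y)%:E).
  exact/measurable_funTS/measurable_EFinP.
have h1 : (\int[lebesgue_Rn]_(y in box v e) (p y)%:E <=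
    (p y + d)%:E * lebesgue_Rn (box v e))%E.
  rewrite -integral_cst//; apply: ge0_le_integral => //.
    by move=> t _; rewrite lee_fin.
  by move=> t /B[tp _]; rewrite lee_fin ltW.
have h2 : ((q y - d)%:E * lebesgue_Rn (box v e) <=
    \int[lebesgue_Rn]_(y in box v e) (q y)%:E)%E.
  rewrite -integral_cst//; apply: ge0_le_integral => //.
    by move=> t _; rewrite lee_fin; have := p0 y; rewrite /d in d0 *; lra.
  by move=> t /B[_ tq]; rewrite lee_fin ltW.
have := le_trans h2 (le_trans _ h1); rewrite pq// => /(_ (lexx _)).
rewrite lebesgue_Rn_box// -!EFinM lee_fin ler_pM2r; last first.
  by rewrite exprn_gt0// mulr_gt0.
by rewrite /d in d0 *; lra.
Unshelve. all: by end_near. Qed.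

Lemma continuous_density_unique (p q : Rn R n -> R) :
  measurable_fun setT p -> measurable_fun setT q ->
  (forall y, 0 <= p y) -> (forall y, 0 <= q y) ->
  continuous (p \o coltuple) -> continuous (q \o coltuple) ->
  (forall A, measurable A ->
    (\int[lebesgue_Rn]_(y in A) (p y)%:E = \int[lebesgue_Rn]_(y in A) (q y)%:E)%E) ->
  forall y, p y = q y.
Proof.
move=> mp mq p0 q0 cp cq pq y; apply/eqP; rewrite eq_le.
by rewrite (continuous_density_le mp mq)// (continuous_density_le mq mp)// => A /pq.
Qed.

End continuous_density.

Section gauss_pdf.
Context {R : realType}.

(** The normalization sits inside the exponential: the log likelihood is then the exponent itself,
    and products and quotients of densities only add exponents. *)
Definition gauss_pdf n (S : 'M[R]_n) (y : 'cV[R]_n) : R :=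
  expR (- 2^-1 * (n%:R * ln (2 * pi) + ln (\det S) + bilin (invmx S) y y)).

Lemma gauss_pdf_gt0 n (S : 'M[R]_n) y : 0 < gauss_pdf S y.
Proof. exact: expR_gt0. Qed.

Lemma continuous_gauss_pdf n (S : 'M[R]_n) : continuous (gauss_pdf S).
Proof.
have h : continuous (fun y : 'cV[R]_n =>
    - 2^-1 * (n%:R * ln (2 * pi) + ln (\det S) + bilin (invmx S) y y)).
  apply: continuous_mulf; first exact: cst_continuous.
  by apply: continuous_addf; [exact: cst_continuous|exact: continuous_bilin].
by move=> v; apply: continuous_comp; [exact: h|exact: continuous_expR].
Qed.

Lemma measurable_gauss_pdf n (S : 'M[R]_n) :
  measurable_fun setT (fun y : Rn R n => gauss_pdf S (tcol y)).
Proof.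
apply: measurableT_comp => //; apply: measurable_funM => //.
by apply: measurable_funD => //; exact: measurable_bilin_tcol.
Qed.

Lemma ln_det_invmx n (S : 'M[R]_n) : pdmx S -> ln (\det (invmx S)) = - ln (\det S).
Proof. by move=> pS; rewrite det_inv lnV// posrE pdmx_det_gt0. Qed.

Lemma integral_gauss_pdf n (S : 'M[R]_n) : pdmx S ->
  (\int[lebesgue_Rn]_y (gauss_pdf S (tcol y))%:E = 1)%E.
Proof.
move=> pS.
transitivity (\int[lebesgue_Rn]_y
  ((expR (- 2^-1 * (n%:R * ln (2 * pi) + ln (\det S))))%:E *
   (expR (- 2^-1 * bilin (invmx S) (tcol y) (tcol y)))%:E))%E.
  by apply: eq_integral => y _; rewrite -EFinM -expRD -mulrDr.
rewrite ge0_integralZl//; last exact: measurable_expR_bilin.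
rewrite integral_gauss; last exact: pdmx_inv.
rewrite -EFinM -expRD ln_det_invmx// opprK mulNr -[X in - X + _]opprK.
by rewrite opprK addNr expR0.
Qed.

End gauss_pdf.

Section observation_density.
Context {R : realType}.

Lemma integral_normal_prob (m s : R) (f : measurableTypeR R -> \bar R) :
  measurable_fun setT f -> (forall x, (0 <= f x)%E) ->
  (\int[normal_prob m s]_x f x =
   \int[lebesgue_measure]_x (f x * (normal_pdf m s x)%:E))%E.
Proof.
apply: ge0_integral_density => //; first exact: measurable_normal_pdf.
by move=> x; exact: normal_pdf_ge0.
Qed.

(** The normalizing constant stays anonymous, because the constant of the observation law is later
    recovered from its total mass. *)
Lemma ge0_integral_diag_normal n (v : 'cV[R]_n) : (forall i, 0 < v i 0) ->
  exists c, forall f : Rn R n -> \bar R, measurable_fun setT f ->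
    (forall x, (0 <= f x)%E) ->
  (\int[diag_normal v]_t f t = \int[lebesgue_Rn]_t (f t *
    (expR (c - 2^-1 * bilin (invmx (diag_mx v^T)) (tcol t) (tcol t)))%:E))%E.
Proof.
move=> v0; exists (\sum_i ln (normal_peak (Num.sqrt (v i 0)))) => f mf f0.
rewrite (@ge0_integral_tuple_measure_density _ _ _ _ _ (fun=> lebesgue_measure)
  (fun i => normal_pdf 0 (Num.sqrt (v i 0))))//; last 3 first.
- by move=> i; exact: measurable_normal_pdf.
- by move=> i x; exact: normal_pdf_ge0.
- by move=> i g mg g0; exact: integral_normal_prob.
apply: eq_integral => t _; congr (_ * _%:E)%E.
have -> : invmx (diag_mx v^T) = diag_mx (\row_i (v i 0)^-1).
  have u : diag_mx v^T \in unitmx.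
    by apply/pdmx_unit/pdmx_diag => i; rewrite mxE.
  apply: (can_inj (mulKmx u)); rewrite mulmxV// mulmx_diag -diag_const_mx.
  by congr diag_mx; apply/rowP => i; rewrite !mxE divff// gt_eqF.
rewrite bilin_diag mulr_sumr -sumrB expR_sum; apply: eq_bigr => i _.
have si0 : Num.sqrt (v i 0) != 0 by rewrite gt_eqF// sqrtr_gt0.
rewrite normal_pdfE// expRD lnK ?posrE ?normal_peak_gt0//; congr (_ * expR _).
rewrite !mxE subr0 sqr_sqrtr ?ltW//.
by field; rewrite gt_eqF.
Qed.

Lemma diag_normal_setT n (v : 'cV[R]_n) : diag_normal v setT = 1%E.
Proof.
have -> : setT = [set t : Rn R n | forall i, [set: R] (tnth t i)].
  by apply/seteqP; split.
rewrite [LHS](@tuple_measureE _ _ _ n _ (fun=> setT)); last by move=> i; exact: measurableT.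
by rewrite big1// => i _; exact: probability_setT.
Qed.

Context {N L : nat} (Phi : 'M[R]_(N, L)) (sigma2 : R).
Hypothesis sigma2_gt0 : 0 < sigma2.
Variable g : 'cV[R]_L.
Hypothesis g_gt0 : forall i, 0 < g i 0.

Lemma pdmx_Sigma_y : pdmx (Sigma_y Phi sigma2 g).
Proof.
apply: pdmxD; first exact: pdmx_scalar.
  by rewrite !trmx_mul trmxK tr_diag_mx mulmxA.
move=> v; rewrite -{1}[Phi]trmxK bilin_mul; apply: pdmx_ge0.
by apply: pdmx_diag => i; rewrite mxE.
Qed.

Let obs (xn : Rn R L * Rn R N) : Rn R N :=
  coltuple (Phi *m tcol xn.1 + tcol xn.2).

Lemma measurable_obs : measurable_fun setT obs.
Proof.
apply: measurable_coltuple => i; under eq_fun do rewrite mxE.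
apply: measurable_funD.
  exact: (measurableT_comp (@measurable_mulmx_tcol _ _ _ Phi i) measurable_fst).
exact: (measurableT_comp (@measurable_tcol _ _ i) measurable_snd).
Qed.

Lemma observation_law_setT : observation_law Phi sigma2 g setT = 1%E.
Proof.
rewrite /observation_law /pushforward preimage_setT -setXTT.
rewrite product_measure1E// [X in (X * _)%E]diag_normal_setT.
by rewrite mul1e; exact: diag_normal_setT.
Qed.

Lemma observation_law_exp : exists c, forall A, measurable A ->
  (observation_law Phi sigma2 g A = \int[lebesgue_Rn]_(y in A)
    (expR (c - 2^-1 * bilin (invmx (Sigma_y Phi sigma2 g)) (tcol y) (tcol y)))%:E)%E.
Proof.
have [c1 xE] := ge0_integral_diag_normal g_gt0.
have [c2 nE] : exists c, forall f : Rn R N -> \bar R, measurable_fun setT f ->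
    (forall x, (0 <= f x)%E) ->
  (\int[diag_normal (const_mx sigma2 : 'cV[R]_N)]_t f t = \int[lebesgue_Rn]_t (f t *
    (expR (c - 2^-1 * (sigma2^-1 * bilin 1%:M (tcol t) (tcol t))))%:E))%E.
  have [|c cE] := @ge0_integral_diag_normal N (const_mx sigma2).
    by move=> i; rewrite mxE.
  exists c => f mf f0; apply: etrans (cE f mf f0) _; apply: eq_integral => t _.
  rewrite trmx_const diag_const_mx -[sigma2%:M]scalemx1 invmxZ ?invmx1 ?unitmx1//.
    by rewrite bilinZm.
  by rewrite scalemx1; exact/pdmx_unit/pdmx_scalar.
pose G : 'M[R]_L := diag_mx g^T.
have pG : pdmx G by apply: pdmx_diag => i; rewrite mxE.
(* The matrix of the quadratic part in [x] of the exponent of [W] below, that is, the conditional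
   precision of [x] given [y]. *)
pose Q := invmx G + sigma2^-1 *: (Phi^T *m Phi).
have pQ : pdmx Q.
  apply: pdmxD; first exact: pdmx_inv.
    by rewrite linearZ/= trmx_mul trmxK.
  move=> v; rewrite bilinZm mulr_ge0 ?invr_ge0 ?(ltW sigma2_gt0)//.
  by rewrite -[Phi^T]mulmx1 bilin_mul pdmx_ge0//; exact: pdmx_scalar.
(* The joint density of [(x, y)]: the density of [x] times that of the noise at [y - Phi x]. *)
pose W (x : Rn R L) (y : Rn R N) := expR (c1 + c2
  - 2^-1 * (sigma2^-1 * bilin 1%:M (tcol y - Phi *m tcol x) (tcol y - Phi *m tcol x))
  - 2^-1 * bilin (invmx G) (tcol x) (tcol x)).
pose c3 := c1 + c2 + 2^-1 * (L%:R * ln (2 * pi) - ln (\det Q)).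
have intW y : (\int[lebesgue_Rn]_x (W x y)%:E = (expR (c3 - 2^-1 *
    bilin (invmx (Sigma_y Phi sigma2 g)) (tcol y) (tcol y)))%:E)%E.
  pose b := sigma2^-1 *: (Phi^T *m tcol y).
  transitivity (\int[lebesgue_Rn]_x
   ((expR (c1 + c2 - 2^-1 * (sigma2^-1 * bilin 1%:M (tcol y) (tcol y))))%:E *
    (expR (- 2^-1 * bilin Q (tcol x) (tcol x) + bilin 1%:M b (tcol x)))%:E))%E.
    apply: eq_integral => x _; rewrite -EFinM -expRD; congr (expR _)%:E.
    rewrite /Q bilinDm bilinZm.
    have -> : bilin (Phi^T *m Phi) (tcol x) (tcol x) =
        bilin 1%:M (Phi *m tcol x) (Phi *m tcol x).
      by rewrite -bilin_mul mulmx1.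
    have -> : bilin 1%:M b (tcol x) =
        sigma2^-1 * bilin 1%:M (tcol y) (Phi *m tcol x).
      by rewrite bilinZl /bilin !mulmx1 trmx_mul trmxK mulmxA.
    rewrite !(bilinDl, bilinDr, bilinNl, bilinNr).
    rewrite [bilin 1%:M (Phi *m _) (tcol y)](bilin_sym (trmx1 _ _)).
    by field; rewrite gt_eqF.
  rewrite ge0_integralZl//; last first.
    apply/measurable_EFinP; apply: measurableT_comp => //.
    apply: measurable_funD; last by apply: measurable_bilin => // i; exact: measurable_tcol.
    by apply: measurable_funM => //; exact: measurable_bilin_tcol.
  rewrite integral_gauss_linear// -EFinM -expRD; congr (expR _)%:E.
  (* Integrating [x] out leaves two quadratic terms in [y], one from the noise and one from the
     centre [Q^-1 b]; Woodbury merges them into the form of the inverse covariance. *)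
  rewrite (@invmx_woodbury _ _ _ Phi G)//; last 4 first.
  - by rewrite gt_eqF.
  - exact: pdmx_unit.
  - exact: pdmx_unit.
  - exact/pdmx_unit/pdmx_Sigma_y.
  rewrite bilinDm bilinNm bilinZm -[(sigma2^-1)%:M]scalemx1 bilinZm.
  rewrite /b bilinZl bilinZr -bilin_mul trmxK /c3 -/Q.
  by field; rewrite gt_eqF.
have mW : measurable_fun setT (fun xy : Rn R L * Rn R N => (W xy.1 xy.2)%:E).
  apply/measurable_EFinP; apply: measurableT_comp => //.
  have mtc i : measurable_fun setT (fun xy : Rn R L * Rn R N =>
      (tcol xy.2 - Phi *m tcol xy.1) i 0).
    have e (xy : Rn R L * Rn R N) : (tcol xy.2 - Phi *m tcol xy.1) i 0 =
        tcol xy.2 i 0 - (Phi *m tcol xy.1) i 0 by rewrite mxE [X in _ + X]mxE.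
    under eq_fun do rewrite e.
    apply: measurable_funB.
      exact: (measurableT_comp (@measurable_tcol _ _ i) measurable_snd).
    exact: (measurableT_comp (@measurable_mulmx_tcol _ _ _ Phi i) measurable_fst).
  apply: measurable_funB.
    apply: measurable_funB => //; apply: measurable_funM => //.
    by apply: measurable_funM => //; exact: measurable_bilin.
  apply: measurable_funM => //; apply: measurable_bilin => i;
    exact: (measurableT_comp (@measurable_tcol _ _ i) measurable_fst).
exists c3 => A mA.
have mhA : measurable (obs @^-1` A).
  by rewrite -[X in measurable X]setTI; exact: measurable_obs.
have mI : measurable_fun setT (fun xn => (\1_(obs @^-1` A) xn)%:E : \bar R).
  exact/measurable_EFinP/measurable_indic.
have mIA : measurable_fun setT (fun y : Rn R N => (\1_A y)%:E : \bar R).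
  exact/measurable_EFinP/measurable_indic.
transitivity (\int[(diag_normal g \x diag_normal (const_mx sigma2 : 'cV[R]_N))%E]_xn
    (\1_(obs @^-1` A) xn)%:E)%E.
  by rewrite integral_indic// setIT.
rewrite fubini_tonelli1//=.
rewrite xE//; last 2 first.
- by apply: (@measurable_fun_fubini_tonelli_F _ _ _ _ _ _
    (fun xn => (\1_(obs @^-1` A) xn)%:E)) => // xn; rewrite lee_fin.
- by move=> x; apply: integral_ge0 => y _; rewrite lee_fin.
transitivity (\int[lebesgue_Rn]_x \int[lebesgue_Rn]_y ((\1_A y)%:E * (W x y)%:E))%E.
  apply: eq_integral => x _.
  rewrite /fubini_F nE//; last first.
    exact: (measurableT_comp mI (measurable_pair1 x)).
  (* For fixed [x] the observation is the noise translated by [Phi x], so translation invariance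
     exchanges the noise variable for [y]. *)
  rewrite -[RHS](@ge0_integral_shift_Rn _ _ (fun i => (Phi *m tcol x) i 0)); last 2 first.
  - apply: emeasurable_funM => //.
    exact: (measurableT_comp mW (measurable_pair1 x)).
  - by move=> y; rewrite mule_ge0// lee_fin ?expR_ge0.
  rewrite -ge0_integralZr//; last first.
    apply: emeasurable_funM; first exact: (measurableT_comp mI (measurable_pair1 x)).
    apply/measurable_EFinP; apply: measurableT_comp => //.
    apply: measurable_funB => //; apply: measurable_funM => //.
    by apply: measurable_funM => //; exact: measurable_bilin_tcol.
  apply: eq_integral => y _.
  have sE : shift_tuple (fun i => (Phi *m tcol x) i 0) y = obs (x, y).
    by apply: eq_from_tnth => i; rewrite !tnth_mktuple [RHS]mxE [tcol y i 0]mxE addrC.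
  have -> : \1_(obs @^-1` A) (x, y) = \1_A (obs (x, y)) :> R.
    by rewrite !indicE; congr (_%:R); apply/idP/idP; rewrite !inE.
  rewrite sE -muleA; congr (_ * _)%E.
  rewrite -EFinM -expRD /W /obs coltupleK/= [_ + tcol y]addrC addrK.
  by congr (expR _)%:E; rewrite -/G; ring.
transitivity (\int[lebesgue_Rn]_y \int[lebesgue_Rn]_x ((\1_A y)%:E * (W x y)%:E))%E.
  apply: (fubini_tonelli (fun xy => ((\1_A xy.2)%:E * (W xy.1 xy.2)%:E)%E)).
    apply: emeasurable_funM => //.
    exact: (measurableT_comp mIA measurable_snd).
  by move=> xy; rewrite mule_ge0// lee_fin ?expR_ge0.
rewrite [RHS]integral_mkcond; apply: eq_integral => y _ /=.
rewrite ge0_integralZl//; last 2 first.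
- exact: (measurableT_comp mW (measurable_pair2 y)).
- by move=> x _; rewrite lee_fin expR_ge0.
by rewrite intW patchE indicE; case: (y \in A); rewrite ?mul1e ?mul0e.
Qed.

Lemma observation_law_gauss_pdf A : measurable A ->
  (observation_law Phi sigma2 g A =
   \int[lebesgue_Rn]_(y in A) (gauss_pdf (Sigma_y Phi sigma2 g) (tcol y))%:E)%E.
Proof.
have [c cE] := observation_law_exp; move=> mA.
have pS := pdmx_Sigma_y; set S := Sigma_y _ _ _ in pS cE *.
(* The constant is forced: over the whole space the law has mass [1], and the Gaussian integral is
   known. *)
suff e : c = - 2^-1 * (N%:R * ln (2 * pi) + ln (\det S)).
  apply: etrans (cE A mA) _; apply: eq_integral => y _; rewrite e /gauss_pdf.
  by congr (expR _)%:E; ring.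
have := cE setT measurableT; rewrite observation_law_setT.
under eq_integral => y _ do rewrite expRD EFinM -mulNr.
rewrite ge0_integralZl//; last exact: measurable_expR_bilin.
rewrite integral_gauss; last exact: pdmx_inv.
rewrite -EFinM -expRD ln_det_invmx// => -[] /esym/eqP.
rewrite -expR0 (inj_eq (@expR_inj _)) => /eqP; lra.
Qed.

Lemma marginal_density_gauss (p : Rn R N -> R) :
  is_density (observation_law Phi sigma2 g) p -> continuous (p \o coltuple) ->
  forall y, p y = gauss_pdf (Sigma_y Phi sigma2 g) (tcol y).
Proof.
move=> [mp p0 pE] cp; apply: continuous_density_unique => //.
- exact: measurable_gauss_pdf.
- by move=> y; rewrite ltW// gauss_pdf_gt0.
- rewrite (_ : _ \o _ = gauss_pdf (Sigma_y Phi sigma2 g)).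
    exact: continuous_gauss_pdf.
  by apply/funext => v; rewrite /= coltupleK.
- by move=> A mA; rewrite -pE// observation_law_gauss_pdf.
Qed.

End observation_density.

(** * Determinants along a line and second moments *)

Section derivative_along_a_line.
Context {R : realType}.

Lemma is_derive_cvg (V : normedModType R) (f : V -> R) (a v : V) (d : R) :
  h^-1 * (f (h *: v + a) - f a) @[h --> 0^'] --> d -> is_derive a v f d.
Proof. by move=> fd; apply: DeriveDef; [apply/cvg_ex; exists d|exact: cvg_lim]. Qed.

Lemma cvg_is_derive (V : normedModType R) (f : V -> R) (a v : V) (d : R) :
  is_derive a v f d -> h^-1 * (f (h *: v + a) - f a) @[h --> 0^'] --> d.
Proof. by case=> fv <-; exact: fv. Qed.

(** Agreement near [0] is all that can be asked, since the closed forms [G] used below hold only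
    while the point of the line remains in the orthant. *)
Lemma is_derive_line (V : normedModType R) (f : V -> R) (a v : V)
    (G : R -> R) (d : R) :
  (\forall t \near 0, f (t *: v + a) = G t) -> is_derive (0 : R) 1 G d ->
  is_derive a v f d.
Proof.
move=> fG /cvg_is_derive Gd; apply: is_derive_cvg.
apply: cvg_trans Gd; apply: near_eq_cvg.
have fa : f a = G 0 by have := nbhs_singleton fG; rewrite scale0r add0r.
apply: cvg_within; near=> h.
have -> : f (h *: v + a) = G h by near: h.
by rewrite fa [h *: 1]mulr1 addr0.
Unshelve. all: by end_near. Qed.

Lemma cvg_diff_quotient0 (G : R -> R) (d : R) : is_derive (0 : R) 1 G d ->
  (G h - G 0) / h @[h --> 0^'] --> d.
Proof.
move=> /cvg_is_derive; under eq_fun do rewrite mulrC [_ *: 1]mulr1 addr0.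
by [].
Qed.

(* The coefficient of the rank-one correction in [bilin_inv_rank1]. *)
Lemma is_derive_rank1_factor (b : R) :
  is_derive (0 : R) 1 (fun t => t / (1 + t * b)) 1.
Proof.
have d1 : is_derive (0 : R) 1 (fun t => 1 + t * b) b.
  by apply: is_derive_eq; rewrite /GRing.scale/=; ring.
have n0 : 1 + 0 * b != 0 by rewrite mul0r addr0 oner_neq0.
have dV := @is_deriveV R (fun t => 1 + t * b) 0 b 1 n0 d1.
by apply: is_derive_eq; rewrite /GRing.scale/= !mul0r addr0 invr1; ring.
Qed.

Lemma is_derive_ln_det n (B : 'M[R]_n) :
  is_derive (0 : R) 1 (fun s => ln (\det (1%:M - s *: B))) (- \tr B).
Proof.
have [r rE] := det_perturb B; under eq_fun do rewrite rE.
pose P s := 1 - s * \tr B + s ^+ 2 * r.[s].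
have P0 : P 0 = 1 by rewrite /P mul0r subr0 expr0n mul0r addr0.
have dP : is_derive (0 : R) 1 P (- \tr B).
  have /derivableP dr : derivable (horner r : R -> R) 0 1 by exact: derivable_horner.
  by apply: is_derive_eq; rewrite /GRing.scale/=; ring.
have ln1 : is_derive (P 0) 1 (@ln R) (P 0)^-1.
  by apply: is_derive1_ln; rewrite P0.
have dc := is_derive1_comp ln1 dP.
by rewrite P0 invr1 mul1r in dc; exact: dc.
Qed.

(** The function [det (1 - s B) ^ (-1/2)] is met twice: with [B] of rank one as a Laplace transform,
    and with [s = t^2] as the chi-square integral. *)
Lemma is_derive_invsqrt_det n (B : 'M[R]_n) :
  is_derive (0 : R) 1 (fun s => expR (- 2^-1 * ln (\det (1%:M - s *: B))))
    (2^-1 * \tr B).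
Proof.
have dl := is_derive_ln_det B; set G := fun s => _ in dl.
pose H s := - 2^-1 * G s.
have dm : is_derive (0 : R) 1 H (2^-1 * \tr B).
  by apply: is_derive_eq; rewrite /GRing.scale/=; ring.
have e0 : H 0 = 0 by rewrite /H /G scale0r subr0 det1 ln1 mulr0.
have dc := is_derive1_comp (is_derive_expR (H 0)) dm.
by rewrite e0 expR0 mul1r in dc; exact: dc.
Qed.

End derivative_along_a_line.

Lemma ln_det_line {R : realType} n (A D : 'M[R]_n) t :
  pdmx A -> pdmx (A + t *: D) ->
  ln (\det (A + t *: D)) = ln (\det A) + ln (\det (1%:M - t *: (- (invmx A *m D)))).
Proof.
move=> pA; have -> : A + t *: D = A *m (1%:M - t *: (- (invmx A *m D))).
  by rewrite mulmxBr mulmx1 -scalemxAr mulmxN mulKVmx ?pdmx_unit// scalerN opprK.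
have dA := pdmx_det_gt0 pA.
move=> /pdmx_det_gt0; rewrite det_mulmx pmulr_rgt0// => d0.
by rewrite lnM ?posrE.
Qed.

Section integrable_nonneg.
Context {d : measure_display} {T : measurableType d} {R : realType}.
Variable mu : {measure set T -> \bar R}.

Lemma integrable_ge0 (f : T -> R) (r : R) :
  measurable_fun setT f -> (forall x, 0 <= f x) ->
  (\int[mu]_x (f x)%:E = r%:E)%E -> mu.-integrable setT (fun x => (f x)%:E).
Proof.
move=> mf f0 fr; apply/integrableP; split; first exact/measurable_EFinP.
by under eq_integral do rewrite gee0_abs ?lee_fin//; rewrite fr ltry.
Qed.

End integrable_nonneg.

Section gaussian_moments.
Context {R : realType} {n : nat}.

Lemma ln_det_ratio (A B C : 'M[R]_n) : pdmx A -> pdmx B -> A *m B = C ->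
  ln (\det A) + ln (\det B) = ln (\det C).
Proof.
by move=> pA pB <-; rewrite det_mulmx lnM// posrE pdmx_det_gt0.
Qed.

(** The Laplace transform of [(a.y)^2 / 2]: the extra factor adds [s a a^T] to the inverse
    covariance, so the integrand remains Gaussian. *)
Lemma integral_gauss_pdf_exp_sq (S : 'M[R]_n) (a : 'cV[R]_n) (s : R) :
  pdmx S -> 0 < s ->
  (\int[lebesgue_Rn]_y
     (expR (- 2^-1 * (s * bilin 1%:M a (tcol y) ^+ 2)) * gauss_pdf S (tcol y))%:E =
   (expR (- 2^-1 * ln (\det (1%:M - s *: (- (S *m (a *m a^T)))))))%:E)%E.
Proof.
move=> pS s0; pose Q := invmx S + s *: (a *m a^T).
have pQ : pdmx Q.
  apply: pdmxD; first exact: pdmx_inv.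
    by rewrite linearZ/= trmx_mul trmxK.
  by move=> v; rewrite bilinZm bilin_outer mulr_ge0 ?(ltW s0)// -expr2 sqr_ge0.
transitivity (\int[lebesgue_Rn]_y
  ((expR (- 2^-1 * (n%:R * ln (2 * pi) + ln (\det S))))%:E *
   (expR (- 2^-1 * bilin Q (tcol y) (tcol y)))%:E))%E.
  apply: eq_integral => y _; rewrite /gauss_pdf -EFinM -!expRD.
  congr (expR _)%:E.
  by rewrite /Q bilinDm bilinZm bilin_outer; ring.
rewrite ge0_integralZl//; last exact: measurable_expR_bilin.
rewrite integral_gauss// -EFinM -expRD; congr (expR _)%:E.
have <- : ln (\det S) + ln (\det Q) =
    ln (\det (1%:M - s *: (- (S *m (a *m a^T))))).
  apply: ln_det_ratio => //.
  by rewrite /Q mulmxDr mulmxV ?pdmx_unit// -scalemxAr scalerN opprK.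
by ring.
Qed.

(** With [w = (a.y)^2 / 2], the quotients [(1 - exp (- s w)) / s] increase to [w] as [s] decreases
    to [0]. Monotone convergence therefore identifies the moment with a derivative of the Laplace
    transform, with no integrability known beforehand. *)
Lemma integral_gauss_pdf_sq (S : 'M[R]_n) (a : 'cV[R]_n) : pdmx S ->
  (\int[lebesgue_Rn]_y (bilin 1%:M a (tcol y) ^+ 2 * gauss_pdf S (tcol y))%:E =
   (bilin S a a)%:E)%E.
Proof.
move=> pS; pose s k : R := 2^-1 ^+ k.
have s0 k : 0 < s k by rewrite exprn_gt0// invr_gt0.
have s_dnbhs : (forall k, s k != 0) /\ s k @[k --> \oo] --> (0 : R).
  split; first by move=> k; rewrite gt_eqF.
  by apply: cvg_expr; rewrite ger0_norm// invf_lt1// ltr1n.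
pose w (y : Rn R n) := 2^-1 * bilin 1%:M a (tcol y) ^+ 2.
have w0 y : 0 <= w y by rewrite mulr_ge0// sqr_ge0.
pose F k y := (1 - expR (- (s k * w y))) / s k * gauss_pdf S (tcol y).
have mw : measurable_fun setT w.
  apply: measurable_funM => //; apply: measurable_funX.
  by apply: measurable_bilin => // i; exact: measurable_tcol.
have mphi := measurable_gauss_pdf S.
have mF k : measurable_fun setT (F k).
  apply: measurable_funM => //; apply: measurable_funM => //.
  apply: measurable_funB => //; apply: measurableT_comp => //.
  by apply: measurableT_comp => //; apply: measurable_funM.
have F0 k y : 0 <= F k y.
  rewrite mulr_ge0 ?(ltW (gauss_pdf_gt0 _ _))// divr_ge0 ?(ltW (s0 k))//.
  by rewrite subr_ge0 expR_le1 oppr_le0 mulr_ge0// ltW.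
have ndF y : nondecreasing_seq (F ^~ y).
  apply/nondecreasing_seqP => k; rewrite /F ler_pM2r ?gauss_pdf_gt0//.
  (* Halving the step makes monotonicity algebraic: with [e = exp (- s k.+1 * w y)], the difference
     to be shown non-negative is [s k.+1 * (1 - e) ^+ 2]. *)
  have sk : s k = s k.+1 + s k.+1 by rewrite /s exprS; field.
  rewrite ler_pdivrMr// mulrAC ler_pdivlMr//.
  have -> : - (s k * w y) = - (s k.+1 * w y) + - (s k.+1 * w y).
    by rewrite sk; ring.
  rewrite expRD sk.
  move: (expR _) => e; rewrite -subr_ge0.
  have -> : (1 - e) * (s k.+1 + s k.+1) - (1 - e * e) * s k.+1 =
      s k.+1 * (1 - e) ^+ 2 by ring.
  by rewrite mulr_ge0 ?sqr_ge0// ltW.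
have intF k : (\int[lebesgue_Rn]_y (F k y)%:E =
    ((1 - expR (- 2^-1 * ln (\det (1%:M - s k *: (- (S *m (a *m a^T))))))) / s k)%:E)%E.
  pose e (y : Rn R n) := expR (- 2^-1 * (s k * bilin 1%:M a (tcol y) ^+ 2)).
  have int_e := integral_gauss_pdf_exp_sq a pS (s0 k).
  have iphi := integrable_ge0 mphi (fun y => ltW (gauss_pdf_gt0 S (tcol y)))
    (integral_gauss_pdf pS).
  have me : measurable_fun setT e.
    apply: measurableT_comp => //; apply: measurable_funM => //.
    apply: measurable_funM => //; apply: measurable_funX.
    by apply: measurable_bilin => // i; exact: measurable_tcol.
  have ie : lebesgue_Rn.-integrable setT (fun y => (e y * gauss_pdf S (tcol y))%:E).
    apply: (integrable_ge0 _ _ int_e); first exact: measurable_funM.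
    by move=> y; rewrite mulr_ge0 ?expR_ge0// ltW// gauss_pdf_gt0.
  transitivity (\int[lebesgue_Rn]_y ((s k)^-1%:E *
      ((gauss_pdf S (tcol y))%:E - (e y * gauss_pdf S (tcol y))%:E)))%E.
    apply: eq_integral => y _; rewrite -EFinB -EFinM; congr EFin.
    rewrite /F /e (_ : - 2^-1 * _ = - (s k * w y)); last by rewrite /w; ring.
    by ring.
  rewrite integralZl//; last exact: integrableB.
  rewrite integralB_EFin// integral_gauss_pdf// int_e.
  by rewrite -EFinB -EFinM mulrC.
have cvF y : (F k y)%:E @[k --> \oo] --> (w y * gauss_pdf S (tcol y))%:E.
  apply: cvg_EFin; first exact: nearW.
  apply: cvgM; last exact: cvg_cst.
  pose u (t : R) := - (t * w y).
  have du : is_derive (0 : R) 1 u (- w y).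
    by apply: is_derive_eq; rewrite /GRing.scale/=; ring.
  have u0 : u 0 = 0 by rewrite /u mul0r oppr0.
  have de := is_derive1_comp (is_derive_expR (u 0)) du.
  rewrite u0 expR0 mul1r in de.
  have /cvgr_dnbhsP/(_ _ s_dnbhs)/cvgN := cvg_diff_quotient0 de.
  rewrite opprK; apply: cvg_trans; apply: near_eq_cvg; apply: nearW => k /=.
  rewrite -[LHS]/(- ((expR (u (s k)) - expR (u 0)) / s k)) u0 expR0 /u.
  by ring.
have : (\int[lebesgue_Rn]_y (F k y)%:E @[k --> \oo] -->
        \int[lebesgue_Rn]_y (w y * gauss_pdf S (tcol y))%:E)%E.
  rewrite (_ : (\int[lebesgue_Rn]_y (w y * gauss_pdf S (tcol y))%:E)%E =
      (\int[lebesgue_Rn]_y (limn (fun k => (F k y)%:E)))%E); last first.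
    by apply: eq_integral => y _; apply/esym/cvg_lim => //; exact: cvF.
  apply: cvg_monotone_convergence => //.
  - by move=> k; exact/measurable_EFinP.
  - by move=> k y _; rewrite lee_fin.
  - by move=> y _ k l kl; rewrite lee_fin; exact: ndF.
under eq_fun do rewrite intF.
have lim2 :
    (((1 - expR (- 2^-1 * ln (\det (1%:M - s k *: (- (S *m (a *m a^T))))))) / s k)%:E : \bar R)
    @[k --> \oo] --> (2^-1 * bilin S a a)%:E.
  apply: cvg_EFin; first exact: nearW.
  have /cvgr_dnbhsP/(_ _ s_dnbhs)/cvgN :=
    cvg_diff_quotient0 (is_derive_invsqrt_det (- (S *m (a *m a^T)))).
  rewrite (_ : \tr (- _) = - bilin S a a); last first.
    by rewrite linearN/= -bilin_mxtrace.
  rewrite mulrN opprK.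
  apply: cvg_trans; apply: near_eq_cvg; apply: nearW => k /=.
  rewrite fctE scale0r subr0 det1 ln1 mulr0 expR0.
  by ring.
move=> /(cvg_unique _)/(_ lim2) => /(_ (@ereal_hausdorff _)) h.
transitivity (2%:E * \int[lebesgue_Rn]_y (w y * gauss_pdf S (tcol y))%:E)%E.
  rewrite -ge0_integralZl//; last 2 first.
  - by apply/measurable_EFinP; apply: measurable_funM.
  - by move=> y _; rewrite lee_fin mulr_ge0// ltW// gauss_pdf_gt0.
  by apply: eq_integral => y _; rewrite -EFinM /w; congr EFin; field.
by rewrite h -EFinM; congr EFin; field.
Qed.

End gaussian_moments.

(** * The score and the Fisher information *)

Section mixed_moments.
Context {R : realType} {n : nat}.
Variable S : 'M[R]_n.
Hypothesis pS : pdmx S.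

Let mlin (a : 'cV[R]_n) : measurable_fun setT (fun y : Rn R n => bilin 1%:M a (tcol y)).
Proof. by apply: measurable_bilin => // i; exact: measurable_tcol. Qed.

Lemma integrable_gauss_pdf :
  lebesgue_Rn.-integrable setT (fun y => (gauss_pdf S (tcol y))%:E).
Proof.
apply: (integrable_ge0 _ _ (integral_gauss_pdf pS)).
  exact: measurable_gauss_pdf.
by move=> y; rewrite ltW// gauss_pdf_gt0.
Qed.

Lemma integrable_gauss_pdf_sq a : lebesgue_Rn.-integrable setT
  (fun y => (bilin 1%:M a (tcol y) ^+ 2 * gauss_pdf S (tcol y))%:E).
Proof.
apply: (integrable_ge0 _ _ (integral_gauss_pdf_sq a pS)).
  apply: measurable_funM; last exact: measurable_gauss_pdf.
  by apply: measurable_funX; exact: mlin.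
by move=> y; rewrite mulr_ge0 ?sqr_ge0// ltW// gauss_pdf_gt0.
Qed.

(* The moment of [(a.y)(b.y)] comes from those of squares by polarization. *)
Lemma gauss_pdf_quadratic (a b : 'cV[R]_n) (k0 k1 : R)
    (f := fun y : Rn R n =>
      (k0 + k1 * (bilin 1%:M a (tcol y) * bilin 1%:M b (tcol y))) *
      gauss_pdf S (tcol y)) :
  lebesgue_Rn.-integrable setT (fun y => (f y)%:E) /\
  (\int[lebesgue_Rn]_y (f y)%:E = (k0 + k1 * bilin S a b)%:E)%E.
Proof.
have ST : S^T = S by case: pS.
have i0 := integrableZl measurableT k0 integrable_gauss_pdf.
have ip := integrableZl measurableT (k1 / 4) (integrable_gauss_pdf_sq (a + b)).
have im := integrableZl measurableT (k1 / 4) (integrable_gauss_pdf_sq (a - b)).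
have fE : (fun y => (f y)%:E) = (fun y =>
    (k0%:E * (gauss_pdf S (tcol y))%:E) +
    ((k1 / 4)%:E * (bilin 1%:M (a + b) (tcol y) ^+ 2 * gauss_pdf S (tcol y))%:E -
    (k1 / 4)%:E * (bilin 1%:M (a - b) (tcol y) ^+ 2 * gauss_pdf S (tcol y))%:E))%E.
  apply/funext => y; rewrite -!EFinM -EFinB -EFinD; congr EFin.
  by rewrite /f !(bilinDl, bilinNl); field.
have ipm := integrableB measurableT ip im.
rewrite fE; split; first exact: integrableD.
rewrite integralD// integralB// !integralZl//; last 3 first.
- exact: integrable_gauss_pdf_sq.
- exact: integrable_gauss_pdf_sq.
- exact: integrable_gauss_pdf.
rewrite integral_gauss_pdf// !integral_gauss_pdf_sq//.
rewrite -!EFinM -EFinB -EFinD; congr EFin.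
by rewrite !(bilinDl, bilinDr, bilinNl, bilinNr) (bilin_sym ST b a); field.
Qed.

End mixed_moments.

Section likelihood.
Context {R : realType} {N L : nat}.
Variables (Phi : 'M[R]_(N, L)) (sigma2 : R).
Hypothesis sigma2_gt0 : 0 < sigma2.
Implicit Types (g v : 'cV[R]_L) (y : Rn R N).

Local Notation S g := (Sigma_y Phi sigma2 g).
Local Notation "'u_ j" := (col j Phi) (at level 2, format "''u_' j").

Lemma positive_orthantP g :
  (g \in (@positive_orthant R L)) = true <-> forall i, 0 < g i 0.
Proof. by split=> [/set_mem //|g0]; exact: mem_set. Qed.

Lemma near_positive_orthant g v : g \in (@positive_orthant R L) ->
  \forall t \near (0 : R), t *: v + g \in (@positive_orthant R L).
Proof.
move=> /positive_orthantP g0.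
have h i : \forall t \near (0 : R), 0 < (t *: v + g) i 0.
  have c : t * v i 0 + g i 0 @[t --> (0 : R)] --> 0 * v i 0 + g i 0.
    by apply: cvgD; [apply: cvgM; [exact: cvg_id|exact: cvg_cst]|exact: cvg_cst].
  near=> t; rewrite !mxE; near: t; apply: (cvgr_gt _ c).
  by rewrite mul0r add0r.
have H := filter_forall (nbhs_filter (0 : R)) h.
by apply: filterS H => t /positive_orthantP.
Unshelve. all: by end_near. Qed.

Lemma pdmx_Sigma g : g \in (@positive_orthant R L) -> pdmx (S g).
Proof. by move=> /positive_orthantP g0; exact: pdmx_Sigma_y. Qed.

Lemma Sigma_y_line g v t :
  S (t *: v + g) = S g + t *: (Phi *m diag_mx v^T *m Phi^T).
Proof.
rewrite /Sigma_y linearD/= linearZ/= raddfD/= linearZ/=.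
by rewrite mulmxDr mulmxDl -scalemxAr -scalemxAl addrA addrAC.
Qed.

Lemma diag_delta j : Phi *m diag_mx (delta_mx j 0 : 'cV[R]_L)^T *m Phi^T = 'u_j *m ('u_j)^T.
Proof.
apply/matrixP => i k; rewrite !mxE big_ord1 (bigD1 j)//= big1 ?addr0.
  by rewrite mul_mx_diag !mxE !eqxx mulr1.
by move=> l lj; rewrite mul_mx_diag !mxE (negbTE lj) mulr0 mul0r.
Qed.

(** Since [t] may be negative, smallness is what keeps the perturbed covariance positive definite
    and the Sherman-Morrison denominator positive. *)
Lemma near_bilin_inv_line g j (x z : 'cV[R]_N) : g \in (@positive_orthant R L) ->
  \forall t \near (0 : R),
    bilin (invmx (S (t *: delta_mx j 0 + g))) x z = bilin (invmx (S g)) x z -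
      t / (1 + t * bilin (invmx (S g)) 'u_j 'u_j) *
        (bilin (invmx (S g)) x 'u_j * bilin (invmx (S g)) 'u_j z).
Proof.
move=> gpos; set b := bilin _ 'u_j 'u_j.
have b0 : 0 <= b by apply: pdmx_ge0; exact/pdmx_inv/pdmx_Sigma.
have c : 1 + t * b @[t --> (0 : R)] --> 1 + 0 * b.
  by apply: cvgD; [exact: cvg_cst|apply: cvgM; [exact: cvg_id|exact: cvg_cst]].
near=> t.
have pt : pdmx (S (t *: delta_mx j 0 + g)).
  by apply: pdmx_Sigma; near: t; exact: near_positive_orthant.
rewrite Sigma_y_line diag_delta in pt *.
rewrite bilin_inv_rank1//; last 3 first.
- exact/pdmx_unit/pdmx_Sigma.
- exact: pdmx_unit.
- rewrite gt_eqF//; near: t; apply: (cvgr_gt _ c).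
  by rewrite mul0r addr0.
by rewrite [in RHS]mulrAC.
Unshelve. all: by end_near. Qed.

Variable p : 'cV[R]_L -> Rn R N -> R.
Hypothesis hp : marginal_density Phi sigma2 p.

Lemma densityE g y : g \in (@positive_orthant R L) -> p g y = gauss_pdf (S g) (tcol y).
Proof.
move=> gpos; have [dp cp] := hp gpos.
by apply: (marginal_density_gauss sigma2_gt0 _ dp cp); exact/positive_orthantP.
Qed.

Definition score_value g j y : R :=
  2^-1 * (bilin (invmx (S g)) 'u_j (tcol y) ^+ 2 - bilin (invmx (S g)) 'u_j 'u_j).

Lemma is_derive_log_lik g j y : g \in (@positive_orthant R L) ->
  is_derive g (delta_mx j 0 : 'cV[R]_L) (log_lik p y) (score_value g j y).
Proof.
move=> gpos; have pS := pdmx_Sigma gpos; have ST : (invmx (S g))^T = invmx (S g).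
  by case: (pdmx_inv pS).
pose psi (t : R) := t / (1 + t * bilin (invmx (S g)) 'u_j 'u_j).
have dpsi : is_derive (0 : R) 1 psi 1 by exact: is_derive_rank1_factor.
pose B := - (invmx (S g) *m ('u_j *m ('u_j)^T)).
pose lam (t : R) := ln (\det (1%:M - t *: B)).
have dlam : is_derive (0 : R) 1 lam (bilin (invmx (S g)) 'u_j 'u_j).
  apply: is_derive_eq; first exact: is_derive_ln_det.
  by rewrite /B linearN/= opprK bilin_mxtrace.
pose d := bilin (invmx (S g)) 'u_j (tcol y).
(* The log likelihood on the line: [t] enters only through [lam], from the determinant, and [psi],
   from the inverse, whose derivatives at [0] are known. *)
pose G t := - 2^-1 * (N%:R * ln (2 * pi) + (ln (\det (S g)) + lam t) +
   (bilin (invmx (S g)) (tcol y) (tcol y) - psi t * d ^+ 2)).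
apply: (@is_derive_line _ _ _ _ _ G).
  near=> t.
  have tpos : t *: delta_mx j 0 + g \in (@positive_orthant R L).
    by near: t; exact: near_positive_orthant.
  rewrite /log_lik densityE// /gauss_pdf expRK.
  have -> : bilin (invmx (S (t *: delta_mx j 0 + g))) (tcol y) (tcol y) =
      bilin (invmx (S g)) (tcol y) (tcol y) - psi t * d ^+ 2.
    rewrite (near (near_bilin_inv_line j (tcol y) (tcol y) gpos) t)//.
    by rewrite (bilin_sym ST (tcol y)) expr2.
  have := pdmx_Sigma tpos; rewrite Sigma_y_line diag_delta => pt.
  by rewrite ln_det_line// addrA.
apply: is_derive_eq; rewrite /score_value -/d /GRing.scale/=.
by field.
Unshelve. all: by end_near. Qed.

Lemma scoreE g j y : g \in (@positive_orthant R L) -> score p j y g = score_value g j y.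
Proof. by move=> gpos; case: (is_derive_log_lik j y gpos). Qed.

Lemma is_derive_score g i j y : g \in (@positive_orthant R L) ->
  is_derive g (delta_mx i 0 : 'cV[R]_L) (score p j y)
    (2^-1 * bilin (invmx (S g)) 'u_j 'u_i ^+ 2 - bilin (invmx (S g)) 'u_j 'u_i *
       (bilin (invmx (S g)) 'u_i (tcol y) * bilin (invmx (S g)) 'u_j (tcol y))).
Proof.
move=> gpos; have pS := pdmx_Sigma gpos; have ST : (invmx (S g))^T = invmx (S g).
  by case: (pdmx_inv pS).
pose psi (t : R) := t / (1 + t * bilin (invmx (S g)) 'u_i 'u_i).
have dpsi : is_derive (0 : R) 1 psi 1 by exact: is_derive_rank1_factor.
have psi0 : psi 0 = 0 by rewrite /psi mul0r.
set c := bilin (invmx (S g)) 'u_j 'u_i.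
set di := bilin _ 'u_i (tcol y); set dj := bilin _ 'u_j (tcol y).
pose G t := 2^-1 * ((dj - psi t * (c * di)) * (dj - psi t * (c * di)) -
  (bilin (invmx (S g)) 'u_j 'u_j - psi t * c ^+ 2)).
apply: (@is_derive_line _ _ _ _ _ G).
  near=> t.
  have tpos : t *: delta_mx i 0 + g \in (@positive_orthant R L).
    by near: t; exact: near_positive_orthant.
  (* The closed form of the score may be differentiated because it holds at every nearby point of
     the line, not only at [g]. *)
  rewrite scoreE// /score_value.
  rewrite (near (near_bilin_inv_line i 'u_j (tcol y) gpos) t)//.
  rewrite (near (near_bilin_inv_line i 'u_j 'u_j gpos) t)//.
  by rewrite (bilin_sym ST 'u_i 'u_j) -/c -/di -/dj -expr2.
apply: is_derive_eq; rewrite psi0 /GRing.scale/=.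
by field.
Unshelve. all: by end_near. Qed.

Lemma log_lik_hessE g i j y : g \in (@positive_orthant R L) ->
  log_lik_hess p i j y g =
    2^-1 * bilin (invmx (S g)) 'u_j 'u_i ^+ 2 - bilin (invmx (S g)) 'u_j 'u_i *
       (bilin (invmx (S g)) 'u_i (tcol y) * bilin (invmx (S g)) 'u_j (tcol y)).
Proof. by move=> gpos; case: (is_derive_score i j y gpos). Qed.

(** Score and Hessian entries both have this shape. The linear forms are those of [S^-1 u_i] and
    [S^-1 u_j], and [S^-1 S S^-1] collapses to [S^-1] in their covariance. *)
Lemma gauss_quadratic_inv g i j (k0 k1 : R) (f := fun y : Rn R N =>
    k0 + k1 * (bilin (invmx (S g)) 'u_i (tcol y) * bilin (invmx (S g)) 'u_j (tcol y))) :
  g \in (@positive_orthant R L) ->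
  integrable_Y p g f /\
  expectation_Y p g f = (k0 + k1 * bilin (invmx (S g)) 'u_i 'u_j)%:E.
Proof.
move=> gpos; have pS := pdmx_Sigma gpos; have ST : (S g)^T = S g by case: pS.
have [If Ef] := gauss_pdf_quadratic pS (invmx (S g) *m 'u_i) (invmx (S g) *m 'u_j) k0 k1.
have e : (fun y => (f y * p g y)%:E) = (fun y => ((k0 + k1 *
    (bilin 1%:M (invmx (S g) *m 'u_i) (tcol y) * bilin 1%:M (invmx (S g) *m 'u_j) (tcol y))) *
      gauss_pdf (S g) (tcol y))%:E).
  by apply/funext => y; rewrite densityE// /f !(bilin_invmx _ _ ST).
rewrite /integrable_Y /expectation_Y e; split => //.
rewrite Ef; congr (_ + _ * _)%:E.
by rewrite -bilin_mul trmx_inv ST mulVmx ?pdmx_unit// mul1mx.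
Qed.

Lemma expectation_score g j : g \in (@positive_orthant R L) ->
  expectation_Y p g (score p j ^~ g) = 0%E.
Proof.
move=> gpos; pose c := bilin (invmx (S g)) 'u_j 'u_j.
have [_ E] := gauss_quadratic_inv j j (- 2^-1 * c) 2^-1 gpos.
rewrite (_ : score p j ^~ g = fun y => - 2^-1 * c + 2^-1 *
  (bilin (invmx (S g)) 'u_j (tcol y) * bilin (invmx (S g)) 'u_j (tcol y))).
  by rewrite E -/c; congr EFin; ring.
by apply/funext => y; rewrite scoreE// /score_value -/c; ring.
Qed.

Lemma expectation_log_lik_hess g i j : g \in (@positive_orthant R L) ->
  integrable_Y p g (log_lik_hess p i j ^~ g) /\
  expectation_Y p g (log_lik_hess p i j ^~ g) =
    (- 2^-1 * bilin (invmx (S g)) 'u_j 'u_i ^+ 2)%:E.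
Proof.
move=> gpos; pose c := bilin (invmx (S g)) 'u_j 'u_i.
have ST : (invmx (S g))^T = invmx (S g) by case: (pdmx_inv (pdmx_Sigma gpos)).
have [I E] := gauss_quadratic_inv i j (2^-1 * c ^+ 2) (- c) gpos.
rewrite (_ : log_lik_hess p i j ^~ g = fun y => 2^-1 * c ^+ 2 + - c *
  (bilin (invmx (S g)) 'u_i (tcol y) * bilin (invmx (S g)) 'u_j (tcol y))).
  by split=> //; rewrite E (bilin_sym ST) -/c; congr EFin; field.
by apply/funext => y; rewrite log_lik_hessE// -/c mulNr.
Qed.

Lemma fisherE g i j : g \in (@positive_orthant R L) ->
  fisher p g i j = 2^-1 * bilin (invmx (S g)) 'u_j 'u_i ^+ 2.
Proof.
move=> gpos; have [_ E] := expectation_log_lik_hess i j gpos.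
by rewrite mxE E /= mulNr opprK.
Qed.

End likelihood.

(** * The Cramer-Rao bound *)

Section has_integral.
Context {d : measure_display} {T : measurableType d} {R : realType}.
Variable mu : {measure set T -> \bar R}.
Implicit Types f : T -> R.

(** Bundling integrability with a real value lets expectations be added, scaled and compared as
    reals. *)
Definition has_integral f (r : R) : Prop :=
  mu.-integrable setT (fun x => (f x)%:E) /\ (\int[mu]_x (f x)%:E = r%:E)%E.

Lemma has_integralD f1 f2 r1 r2 : has_integral f1 r1 -> has_integral f2 r2 ->
  has_integral (fun x => f1 x + f2 x) (r1 + r2).
Proof.
move=> [i1 e1] [i2 e2]; split.
  by under eq_fun do rewrite EFinD; exact: integrableD.
by under eq_integral do rewrite EFinD; rewrite integralD// e1 e2.
Qed.

Lemma has_integralZ f r c : has_integral f r -> has_integral (fun x => c * f x) (c * r).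
Proof.
move=> [i e]; split; first by under eq_fun do rewrite EFinM; exact: integrableZl.
by under eq_integral do rewrite EFinM; rewrite integralZl// e.
Qed.

Lemma has_integral_sum (I : Type) (s : seq I) (f : I -> T -> R) (r : I -> R) :
  (forall i, has_integral (f i) (r i)) ->
  has_integral (fun x => \sum_(i <- s) f i x) (\sum_(i <- s) r i).
Proof.
move=> fr; elim: s => [|i s IHs].
  rewrite big_nil; under eq_fun do rewrite big_nil.
  by split; [exact: integrable0|rewrite integral0].
rewrite big_cons; under eq_fun do rewrite big_cons.
exact: has_integralD.
Qed.

Lemma eq_has_integral f1 f2 r1 r2 : (forall x, f1 x = f2 x) -> r1 = r2 ->
  has_integral f1 r1 -> has_integral f2 r2.
Proof. by move=> /funext <- <-. Qed.

Lemma has_integral_le f1 f2 r1 r2 : has_integral f1 r1 -> has_integral f2 r2 ->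
  (forall x, f1 x <= f2 x) -> r1 <= r2.
Proof.
move=> [i1 e1] [i2 e2] f12; rewrite -lee_fin -e1 -e2.
by apply: le_integral => // x _; rewrite lee_fin.
Qed.

End has_integral.

Section chi_square.
Context {R : realType} {n : nat}.
Variables (S D : 'M[R]_n) (t : R).
Hypotheses (DT : D^T = D) (pS : pdmx S).
Hypotheses (pp : pdmx (S + t *: D)) (pm : pdmx (S - t *: D)).

(* [K] is the Schur complement of the block matrix [S, t D; t D, S], which is
   congruent to [diag (S + t D, S - t D)]. *)
Let K := S - t ^+ 2 *: (D *m invmx S *m D).

Lemma pdmx_chi_square : pdmx K.
Proof.
have ST : S^T = S by case: pS.
split=> [|v v0].
  by rewrite /K linearB/= linearZ/= !trmx_mul DT trmx_inv ST mulmxA.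
(* The [w] minimizing the block form at [(v, w)], where its value is that of [K] at [v]. That block
   form is half the sum of the forms of [S + t D] at [v + w] and of [S - t D] at [v - w], which do
   not both vanish when [v != 0]. *)
pose w := - t *: (invmx S *m (D *m v)).
have -> : bilin K v v = 2^-1 * (bilin (S + t *: D) (v + w) (v + w) +
                               bilin (S - t *: D) (v - w) (v - w)).
  have e1 : bilin S w w = t ^+ 2 * bilin (D *m invmx S *m D) v v.
    rewrite /w bilinZl bilinZr -{3}DT bilin_mul.
    rewrite -[RHS]mulr1 /bilin trmx_mul trmx_inv ST.
    rewrite !mulmxA mulmxKV ?pdmx_unit//.
    by ring.
  have e2 : bilin D v w = - t * bilin (D *m invmx S *m D) v v.
    by rewrite /w bilinZr /bilin !mulmxA.
  rewrite /K !(bilinDl, bilinDr, bilinDm, bilinNm, bilinZm, bilinNl, bilinNr).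
  by rewrite (bilin_sym DT w v) (bilin_sym ST w v) e2 e1; field.
have [vw|vw] := eqVneq (v + w) 0.
  have vw0 : v - w != 0.
    apply: contraNneq v0 => vw0.
    have -> : v = 2^-1 *: ((v + w) + (v - w)).
      rewrite addrACA subrr addr0 -[v + v]mulr2n -[v *+ 2]scaler_nat scalerA.
      by rewrite mulVf ?scale1r// pnatr_eq0.
    by rewrite vw vw0 addr0 scaler0.
  rewrite mulr_gt0// ltr_wpDl//; first by apply: pdmx_ge0; exact: pp.
  by case: pm => _; apply.
rewrite mulr_gt0// ltr_pwDl//; last by apply: pdmx_ge0; exact: pm.
by case: pp => _; apply.
Qed.

(** The integrand is an unnormalized Gaussian of matrix [Q = 2 St^-1 - S^-1 = St^-1 K St^-1], with
    [St = S + t D]. The determinants of [St] cancel, leaving [det (S^-1 K)]. *)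
Lemma integral_chi_square : has_integral lebesgue_Rn
  (fun y => gauss_pdf (S + t *: D) (tcol y) ^+ 2 / gauss_pdf S (tcol y))
  (expR (- 2^-1 * ln (\det (1%:M - t ^+ 2 *: (invmx S *m (D *m invmx S *m D)))))).
Proof.
pose St := S + t *: D; have pK := pdmx_chi_square.
have uS := pdmx_unit pS; have uSt : St \in unitmx := pdmx_unit pp.
have StT : St^T = St by case: pp.
pose Q := 2 *: invmx St - invmx S.
have QE : Q = (invmx St)^T *m K *m invmx St.
  have SS : St *m invmx S *m St = S + (2 * t) *: D + t ^+ 2 *: (D *m invmx S *m D).
    rewrite /St mulmxDl mulmxV// mulmxDr mulmxDl !mul1mx mulmxDl.
    rewrite -!(scalemxAl, scalemxAr) mulmxKV// scalerA -expr2 addrA; congr (_ + _).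
    by rewrite mul1mx -addrA -scalerDl; congr (_ + _ *: _); ring.
  have KE : K = St *m Q *m St.
    rewrite /Q mulmxBr mulmxBl SS -scalemxAr -scalemxAl mulmxV// mul1mx /K /St.
    rewrite scalerDr scalerA opprD opprD addrA; congr (_ - _).
    rewrite addrAC addrA -scaleNr -!addrA -scalerDl addNr scale0r addr0.
    by rewrite scaler_nat mulr2n addrK.
  by rewrite KE trmx_inv StT -mulmxA mulmxK// mulKmx.
have pQ : pdmx Q by rewrite QE; apply: pdmx_congr => //; rewrite unitmx_inv.
have lnQ : ln (\det Q) = ln (\det K) - 2 * ln (\det St).
  have dSt := pdmx_det_gt0 pp; have dK := pdmx_det_gt0 pK.
  rewrite QE !det_mulmx det_tr det_inv !lnM ?posrE ?mulr_gt0 ?invr_gt0//.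
  by rewrite lnV ?posrE//; ring.
have lnK : ln (\det K) = ln (\det S) +
    ln (\det (1%:M - t ^+ 2 *: (invmx S *m (D *m invmx S *m D)))).
  have KE : K = S + t ^+ 2 *: (- (D *m invmx S *m D)) by rewrite scalerN.
  by rewrite {1}KE ln_det_line ?mulmxN ?opprK// -KE.
pose c := - 2^-1 * (n%:R * ln (2 * pi) + 2 * ln (\det St) - ln (\det S)).
have fE y : gauss_pdf St (tcol y) ^+ 2 / gauss_pdf S (tcol y) =
    expR c * expR (- 2^-1 * bilin Q (tcol y) (tcol y)).
  rewrite /gauss_pdf expr2 -expRN -!expRD; congr expR.
  by rewrite /Q bilinDm bilinNm bilinZm /c; field.
have mf : measurable_fun setT (fun y : Rn R n =>
    expR c * expR (- 2^-1 * bilin Q (tcol y) (tcol y))).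
  apply: measurable_funM => //; apply: measurableT_comp => //.
  by apply: measurable_funM => //; exact: measurable_bilin_tcol.
have int_f : (\int[lebesgue_Rn]_y (expR c * expR (- 2^-1 * bilin Q (tcol y) (tcol y)))%:E =
  (expR (- 2^-1 * ln (\det (1%:M - t ^+ 2 *: (invmx S *m (D *m invmx S *m D))))))%:E)%E.
  under eq_integral do rewrite EFinM.
  rewrite ge0_integralZl//; last exact: measurable_expR_bilin.
  rewrite integral_gauss// -EFinM -expRD; congr (expR _)%:E.
  by rewrite lnQ lnK /c; field.
apply: (@eq_has_integral _ _ _ _ _ _ _ _ (fun y => esym (fE y)) erefl).
split=> //; apply: (integrable_ge0 mf _ int_f) => y.
by rewrite mulr_ge0// expR_ge0.
Qed.

End chi_square.

Section cramer_rao.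
Context {R : realType} {N L : nat}.
Variables (Phi : 'M[R]_(N, L)) (sigma2 : R).
Hypothesis sigma2_gt0 : 0 < sigma2.
Variable p : 'cV[R]_L -> Rn R N -> R.
Hypothesis hp : marginal_density Phi sigma2 p.
Variable est : Rn R N -> Rn R L.
Hypotheses (mest : measurable_fun setT est) (adm : admissible p est).
Implicit Types (g v a : 'cV[R]_L).

Local Notation S g := (Sigma_y Phi sigma2 g).
Local Notation phi g y := (gauss_pdf (S g) (tcol y)).
Local Notation has_int := (has_integral lebesgue_Rn).

Lemma measurable_est i : measurable_fun setT (fun y => tcol (est y) i 0).
Proof. exact: (measurableT_comp (@measurable_tcol R L i) mest). Qed.

Lemma has_integral_density g : g \in (@positive_orthant R L) ->
  has_int (fun y => phi g y) 1.
Proof.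
move=> gpos; have pS := pdmx_Sigma Phi sigma2_gt0 gpos.
by split; [exact: integrable_gauss_pdf|exact: integral_gauss_pdf].
Qed.

Lemma sq_errorE g y i j : sq_error est g y i j =
  (tcol (est y) i 0 - g i 0) * (tcol (est y) j 0 - g j 0).
Proof. by rewrite mxE big_ord1 ![((_ - _)^T) _ _]mxE !mxE; ring. Qed.

Lemma has_integral_sq_error g i j : g \in (@positive_orthant R L) ->
  has_int (fun y => sq_error est g y i j * phi g y) (mse p est g i j).
Proof.
move=> gpos; have [ie _] := adm gpos.
have e : (fun y => sq_error est g y i j * p g y) =
         (fun y => sq_error est g y i j * phi g y).
  by apply/funext => y; rewrite (densityE sigma2_gt0 hp).
have := ie i j; rewrite /integrable_Y.
under eq_fun do rewrite (densityE sigma2_gt0 hp) //.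
move=> ii; split=> //.
rewrite mxE /expectation_Y fineK; last first.
  under eq_integral do rewrite (densityE sigma2_gt0 hp) //.
  exact: integrable_fin_num.
by apply: eq_integral => y _; rewrite (densityE sigma2_gt0 hp).
Qed.

(** Integrability comes from the finite mean square error through [|e| <= (e - h)^2 + 1 + |h|], and
    the value from unbiasedness. *)
Lemma has_integral_est g i : g \in (@positive_orthant R L) ->
  has_int (fun y => tcol (est y) i 0 * phi g y) (g i 0).
Proof.
move=> gpos; have [_ un] := adm gpos.
have [i1 _] := has_integralD (has_integral_sq_error i i gpos)
  (has_integralZ (1 + `|g i 0|) (has_integral_density gpos)).
split; last first.
  rewrite -un; apply: eq_integral => y _.
  by rewrite (densityE sigma2_gt0 hp).
apply: le_integrable i1 => //.
  apply/measurable_EFinP; apply: measurable_funM; last exact: measurable_gauss_pdf.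
  exact: measurable_est.
move=> y _ /=; rewrite lee_fin -mulrDl !normrM.
rewrite ler_wpM2r// sq_errorE -expr2.
set e := tcol (est y) i 0; set h := g i 0.
rewrite [leRHS]ger0_norm; last by rewrite addr_ge0 ?sqr_ge0// addr_ge0.
apply: (@le_trans _ _ (`|e - h| + `|h|)); first by rewrite -{1}(subrK h e) ler_normD.
rewrite addrA lerD2r -subr_ge0 -[(e - h) ^+ 2]real_normK ?num_real//.
have := sqr_ge0 (`|e - h| - 2^-1); rewrite sqrrB; set n := `|_|.
by move=> ?; lra.
Qed.

(** Centre and law are decoupled because the bound takes the error about [g] under the law at
    [g + t a] as well. *)
Lemma has_integral_linear g g' v : g' \in (@positive_orthant R L) ->
  has_int (fun y => bilin 1%:M v (tcol (est y) - g) * phi g' y)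
    (bilin 1%:M v (g' - g)).
Proof.
move=> gpos.
have h1 := has_integral_sum (index_enum 'I_L)
  (fun i => has_integralZ (v i 0) (has_integral_est i gpos)).
have h2 := has_integralZ (- bilin 1%:M v g) (has_integral_density gpos).
apply: eq_has_integral (has_integralD h1 h2) => [y|]; last first.
  by rewrite bilinDr bilinNr mulr1 [in RHS]bilin1.
rewrite bilinDr bilinNr mulrDl; congr (_ + _).
by rewrite bilin1 mulr_suml; apply: eq_bigr => i _; rewrite mulrA.
Qed.

Lemma has_integral_square g v : g \in (@positive_orthant R L) ->
  has_int (fun y => bilin 1%:M v (tcol (est y) - g) ^+ 2 * phi g y)
    (bilin (mse p est g) v v).
Proof.
move=> gpos.
have h := has_integral_sum (index_enum 'I_L) (fun i =>
  has_integral_sum (index_enum 'I_L) (fun j =>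
    has_integralZ (v i 0 * v j 0) (has_integral_sq_error i j gpos))).
apply: eq_has_integral h => [y|].
  rewrite bilin1 expr2 mulr_suml mulr_suml; apply: eq_bigr => i _.
  rewrite mulr_sumr mulr_suml; apply: eq_bigr => j _.
  rewrite sq_errorE; set x := tcol _ i 0; set z := tcol _ j 0.
  have e k : (tcol (est y) - g) k 0 = tcol (est y) k 0 - g k 0.
    by rewrite mxE [X in _ + X]mxE.
  by rewrite !e -/x -/z; ring.
rewrite bilin_sum; apply: eq_bigr => i _; apply: eq_bigr => j _.
by ring.
Qed.

(* The Hammersley--Chapman--Robbins inequality, in the form obtained by
   integrating [2 t Z W <= t^2 Z^2 + W^2] with [W = p(y; g + t a)/p(y; g) - 1],
   in the limit [t -> 0]. *)
Lemma mse_bound g a v (D := Phi *m diag_mx a^T *m Phi^T) :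
  g \in (@positive_orthant R L) ->
  2 * bilin 1%:M v a <= bilin (mse p est g) v v +
    2^-1 * \tr (invmx (S g) *m (D *m invmx (S g) *m D)).
Proof.
move=> gpos; have pS := pdmx_Sigma Phi sigma2_gt0 gpos.
have DT : D^T = D by rewrite !trmx_mul trmxK tr_diag_mx mulmxA.
set B := invmx (S g) *m _; set A := bilin (mse _ _ _) _ _.
(* The chi-square integral as a function of [h = t ^+ 2]: after division by [t ^+ 2] the bound is a
   difference quotient of [X] at [0]. *)
pose X h := expR (- 2^-1 * ln (\det (1%:M - h *: B))).
pose s k : R := 2^-1 ^+ k.
have s0 k : 0 < s k by rewrite exprn_gt0// invr_gt0.
have scv : s k @[k --> \oo] --> (0 : R).
  by apply: cvg_expr; rewrite ger0_norm// invf_lt1// ltr1n.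
have s2_dnbhs : (forall k, s k ^+ 2 != 0) /\ s k ^+ 2 @[k --> \oo] --> (0 : R).
  split; first by move=> k; rewrite gt_eqF// exprn_gt0.
  by have h := cvgM scv scv; rewrite mulr0 in h; exact: h.
have X0 : X 0 = 1 by rewrite /X scale0r subr0 det1 ln1 mulr0 expR0.
have key : \forall k \near \oo, 2 * bilin 1%:M v a - A <=
    (X (s k ^+ 2) - X 0) / s k ^+ 2.
  near=> k.
  have tp : s k *: a + g \in (@positive_orthant R L).
    by near: k; exact: (scv _ (near_positive_orthant a gpos)).
  have tm : s k *: (- a) + g \in (@positive_orthant R L).
    by near: k; exact: (scv _ (near_positive_orthant (- a) gpos)).
  have {s0} := s0 k; set t := s k in tp tm *; move=> t0.
  have pp := pdmx_Sigma Phi sigma2_gt0 tp; rewrite Sigma_y_line in pp.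
  have pm := pdmx_Sigma Phi sigma2_gt0 tm.
  have DN : Phi *m diag_mx (- a)^T *m Phi^T = - D.
    by rewrite linearN/= raddfN/= mulmxN mulNmx.
  rewrite Sigma_y_line DN scalerN in pm.
  have chi := integral_chi_square DT pS pp pm; rewrite -/B -Sigma_y_line in chi.
  have Zt := has_integral_linear g v tp; have Z0 := has_integral_linear g v gpos.
  have lhs := has_integralD (has_integralZ (2 * t) Zt) (has_integralZ (- (2 * t)) Z0).
  have rhs := has_integralD (has_integralZ (t ^+ 2) (has_integral_square v gpos))
    (has_integralD chi (has_integralD (has_integralZ (- 2) (has_integral_density tp))
      (has_integral_density gpos))).
  have := has_integral_le lhs rhs.
  have -> : bilin 1%:M v (g - g) = 0 by rewrite bilinDr bilinNr subrr.
  rewrite addrK bilinZr mulr0 addr0.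
  rewrite -/A -/(X (t ^+ 2)) mulr1 => H.
  (* By unbiasedness the means at [g + t a] and [g] differ by [t a], which gives the left side;
     [X (t ^+ 2) - 1] is the chi-square divergence. Pointwise, the difference of the integrands is a
     square divided by the density at [g]. *)
  have {}H : 2 * t * (t * bilin 1%:M v a) <= t ^+ 2 * A + (X (t ^+ 2) + (- 2 + 1)).
    apply: H => y; set z := bilin _ _ _; set f := gauss_pdf (S g) _.
    set h := gauss_pdf (S (t *: a + g)) _; have f0 : 0 < f by exact: gauss_pdf_gt0.
    rewrite -subr_ge0.
    have -> : t ^+ 2 * (z ^+ 2 * f) + (h ^+ 2 / f + (- 2 * h + f)) -
        (2 * t * (z * h) + - (2 * t) * (z * f)) = (t * z * f - (h - f)) ^+ 2 / f.
      by field; rewrite gt_eqF.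
    by rewrite divr_ge0 ?sqr_ge0// ltW.
  rewrite X0 ler_pdivlMr ?exprn_gt0//.
  by move: H; set x := X _; set b := bilin _ _ _; lra.
have /cvgr_dnbhsP/(_ _ s2_dnbhs) XB := cvg_diff_quotient0 (is_derive_invsqrt_det B).
rewrite -lerBlDl -(cvg_lim _ XB)//.
by apply: limr_ge; [apply/cvg_ex; exists (2^-1 * \tr B)|exact: key].
Unshelve. all: by end_near. Qed.

(** By cyclicity the trace is that of [(P diag(a))^2] with [P = Phi^T S^-1 Phi], that is, the sum of
    [a_i a_j P_ij^2], and half of [P_ij^2] is the Fisher entry. *)
Lemma trace_fisher g a (D := Phi *m diag_mx a^T *m Phi^T) :
  g \in (@positive_orthant R L) ->
  2^-1 * \tr (invmx (S g) *m (D *m invmx (S g) *m D)) = bilin (fisher p g) a a.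
Proof.
move=> gpos; pose P := Phi^T *m invmx (S g) *m Phi.
have PE i j : bilin (invmx (S g)) (col i Phi) (col j Phi) = P i j.
  rewrite !colE -bilin_mul /bilin trmx_delta -rowE -colE !mxE.
  by [].
have ST : (invmx (S g))^T = invmx (S g).
  by case: (pdmx_inv (pdmx_Sigma Phi sigma2_gt0 gpos)).
have PT i j : P j i = P i j by rewrite -!PE (bilin_sym ST).
have PaE i j : (P *m diag_mx a^T) i j = P i j * a j 0.
  by rewrite mul_mx_diag mxE [a^T 0 j]mxE.
have -> : \tr (invmx (S g) *m (D *m invmx (S g) *m D)) =
    \tr (P *m diag_mx a^T *m (P *m diag_mx a^T)).
  by rewrite /D !mulmxA mxtrace_mulC !mulmxA.
rewrite /mxtrace bilin_sum mulr_sumr; apply: eq_bigr => i _.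
rewrite mxE mulr_sumr; apply: eq_bigr => j _.
rewrite (fisherE sigma2_gt0 hp)// PE !PaE (PT i j).
by ring.
Qed.

Lemma cramer_rao g : g \in (@positive_orthant R L) -> fisher p g \in unitmx ->
  loewner_ge (mse p est g) (invmx (fisher p g)).
Proof.
move=> gpos uM; set M := fisher p g in uM *.
have ST : (invmx (S g))^T = invmx (S g).
  by case: (pdmx_inv (pdmx_Sigma Phi sigma2_gt0 gpos)).
have MT : M^T = M.
  by apply/matrixP => i j; rewrite mxE !(fisherE sigma2_gt0 hp)// (bilin_sym ST).
have ET : (mse p est g)^T = mse p est g.
  apply/matrixP => i j; rewrite !mxE; congr (fine (expectation_Y _ _ _)).
  by apply/funext => y; rewrite !sq_errorE mulrC.
split; first by rewrite linearB/= trmx_inv MT ET.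
move=> v; rewrite -/(bilin _ v v) bilinDm bilinNm subr_ge0.
(* The direction for which the lower bound [2 v.a - a^T M a] on the form of the mean square error at
   [v] is largest; its value there is [v^T M^-1 v]. *)
pose a := invmx M *m v.
have va : bilin 1%:M v a = bilin (invmx M) v v by rewrite /bilin mulmx1 mulmxA.
have aa : bilin M a a = bilin (invmx M) v v.
  by rewrite /a -bilin_mul trmx_inv MT mulVmx// mul1mx.
have := mse_bound a v gpos; rewrite trace_fisher// va aa.
by rewrite mulr_natl mulr2n lerD2r.
Qed.

End cramer_rao.

Unset Implicit Arguments.

Theorem theorem1 (R : realType) (N L : nat) (hN : (1 <= N)%N) (hL : (1 <= L)%N)
    (Phi : 'M[R]_(N, L)) (sigma2 : R) (hsigma2 : 0 < sigma2)
    (p : 'cV[R]_L -> Rn R N -> R) (hp : marginal_density Phi sigma2 p) :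
  (forall g : 'cV[R]_L, g \in positive_orthant -> forall j : 'I_L,
     (forall y, derivable (log_lik p y) g (delta_mx j 0)) /\
     expectation_Y p g (score p j ^~ g) = 0%E) /\
  (forall g : 'cV[R]_L, g \in positive_orthant ->
     (forall i j : 'I_L,
        [/\ forall y, derivable (score p j y) g (delta_mx i 0),
            integrable_Y p g (log_lik_hess p i j ^~ g) &
            fisher p g i j =
              2^-1 * (((col j Phi)^T *m invmx (Sigma_y Phi sigma2 g)
                        *m col i Phi) 0 0) ^+ 2]) /\
     (fisher p g \in unitmx ->
        forall est : Rn R N -> Rn R L, measurable_fun setT est ->
          admissible p est ->
          loewner_ge (mse p est g) (invmx (fisher p g)))).
Proof.
split=> [g gpos j|g gpos]; first split.
- by move=> y; case: (is_derive_log_lik hsigma2 hp j y gpos).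
- exact: (expectation_score hsigma2 hp j gpos).
split=> [i j|uM est mest adm]; last exact: (cramer_rao hsigma2 hp).
split.
- by move=> y; case: (is_derive_score hsigma2 hp i j y gpos).
- by have [] := expectation_log_lik_hess hsigma2 hp i j gpos.
- exact: (fisherE hsigma2 hp i j gpos).
Qed.
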